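(* Let $Z\subset\mathbb{R}^n$ be an $n$-dimensional lattice zonotope. Then for $i=0,\dots,n$, $$\frac{\mathrm{g}_i(Z)}{\mathrm{vol}(Z)}\leq \frac{n!}{i!}\prod_{j=i+1}^n\lambda_j(DZ),$$ and in particular $\mathrm{g}_i(Z)\leq \frac{n!}{i!}\,\sigma_i(Z)$.
   Context: A lattice zonotope is a set $Z=\sum_{i=1}^m[p_i,p_i+v_i]$ with $p_i,v_i\in\mathbb{Z}^n$. $\mathrm{vol}$ is $n$-dimensional Lebesgue measure. For an $n$-dimensional lattice polytope $P$, $\#(kP\cap\mathbb{Z}^n)=\sum_{i=0}^n\mathrm{g}_i(P)k^i$ for $k\in\mathbb{N}$. For a $0$-symmetric convex body $K$, $\lambda_i(K)=\min\{\lambda>0:\dim(\lambda K\cap\mathbb{Z}^n)\ge i\}$ (dimension of the affine hull). $DZ=Z-Z$ and $\sigma_i(Z)=\sigma_i(1/\lambda_1(DZ),\dots,1/\lambda_n(DZ))$, with $\sigma_i$ the $i$th elementary symmetric polynomial. *)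

(* Defs.v *)
From HB Require Import structures.
From mathcomp Require Import all_boot all_order all_algebra.
From mathcomp Require Import all_classical all_reals all_analysis.

Set Implicit Arguments.
Unset Strict Implicit.
Unset Printing Implicit Defensive.

Import Order.TTheory GRing.Theory Num.Theory.
Local Open Scope classical_set_scope.
Local Open Scope ring_scope.

Section Defs.
Variable R : realType.

Definition intvec (n : nat) (z : 'rV[int]_n) : 'rV[R]_n := map_mx (fun a => a%:~R) z.

Definition latticeR (n : nat) : set 'rV[R]_n := [set x | exists z, x = intvec z].

Definition lattice_zonotope (n m : nat) (p v : 'I_m -> 'rV[int]_n) : set 'rV[R]_n :=
  [set x | exists t : 'I_m -> R, (forall i, 0 <= t i <= 1) /\
     x = \sum_(i < m) (intvec (p i) + t i *: intvec (v i))].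

Definition dilate (n : nat) (c : R) (K : set 'rV[R]_n) : set 'rV[R]_n :=
  [set c *: x | x in K].

Definition diff_body (n : nat) (K : set 'rV[R]_n) : set 'rV[R]_n :=
  [set x - y | x in K & y in K].

Definition affdim_ge (n : nat) (S : set 'rV[R]_n) (k : nat) : Prop :=
  exists a : 'I_k.+1 -> 'rV[R]_n, (forall j, S (a j)) /\
    row_free (\matrix_(j < k) (a (lift ord0 j) - a ord0)).

Definition full_dim (n : nat) (S : set 'rV[R]_n) : Prop := affdim_ge S n.

Definition succ_min (n : nat) (K : set 'rV[R]_n) (i : nat) : R :=
  inf [set l : R | 0 < l /\ affdim_ge (dilate l K `&` @latticeR n) i].

Definition card_is (n : nat) (S : set 'rV[int]_n) (N : nat) : Prop :=
  exists s : seq 'rV[int]_n, uniq s /\ (forall z, z \in s <-> S z) /\ size s = N.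

Definition lattice_pts (n : nat) (P : set 'rV[R]_n) (k : nat) : set 'rV[int]_n :=
  [set z | dilate k%:R P (intvec z)].

(* n-dimensional volume, defined by iterated (Cavalieri/Fubini) Lebesgue
   integration of the sections along the first coordinate. *)
Fixpoint ivol (n : nat) : set 'rV[R]_n -> \bar R :=
  match n with
  | 0 => fun A => if `[< A 0 >] then 1%E else 0%E
  | n'.+1 => fun A =>
      (\int[@lebesgue_measure R]_x ivol [set y : 'rV[R]_n' | A (row_mx (\row_(_ < 1) x) y)])%E
  end.

Definition vol (n : nat) (A : set 'rV[R]_n) : R := fine (ivol A).

Definition elem_sym (n : nat) (x : 'I_n -> R) (i : nat) : R :=
  \sum_(I : {set 'I_n} | #|I| == i) \prod_(j in I) x j.

Definition sigmaZ (n : nat) (Z : set 'rV[R]_n) (i : nat) : R :=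
  elem_sym (fun j : 'I_n => (succ_min (diff_body Z) j.+1)^-1) i.

End Defs.

(* Main.v *)
Require Import Defs.
From HB Require Import structures.
From mathcomp Require Import all_boot all_order all_algebra.
From mathcomp Require Import all_classical all_reals all_analysis measurable_realfun.
From mathcomp Require Import zify ring lra.
From mathcomp Require perm.
Import Order.TTheory GRing.Theory Num.Theory.
Local Open Scope classical_set_scope.
Local Open Scope ring_scope.

(** Up to translation [Z] is the sum of the segments [[0, v_j]].  Deleting and contracting one
    generator at a time shows that [g_i] is at most the sum, over the [i]-subfamilies [S] of the
    generators, of the least nonzero value of [|det (v_S, w)|] for integral [w], with
    [g_n = \sum_B |det v_B|].  For each [S] one finds lattice vectors [u_k] in
    [(lambda_k + eps) DZ], [i < k <= n], completing [v_S]; as [u_k] is a combination of the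
    generators with coefficients at most [lambda_k + eps] in absolute value, expanding
    [|det (v_S, u)|] and counting how often each basis [B] occurs gives
    [g_i <= n! / i! * prod_(k > i) lambda_k * g_n].

    The first bound follows, because the unit cubes at the lattice points of [kZ] fit into
    [(k + r) Z] for a fixed [r], so that [vol Z >= g_n].  The second one needs Minkowski's second
    theorem, [g_n * prod_k lambda_k <= 1].  In a basis of the lattice adapted to the successive
    minima, Minkowski's proof is carried out by counting: one counts the lattice points of [aZ]
    modulo [q] in the last coordinates and exactly in the first [d] ones.  When [d] drops by one
    nothing is lost as long as [a / q < lambda_(n - d + 1)], and for fixed [d] dilating by [c]
    multiplies the count by at least [c ^ d], up to a bounded change of [a]. *)

Set Implicit Arguments.
Unset Strict Implicit.
Unset Printing Implicit Defensive.

(** * Sums of segments and their lattice points *)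

Section Zon.
Variable R : realType.

(** Peeling off one generator at a time makes deletion of the first generator the passage to the
    tail. *)
Fixpoint zon (n : nat) (vs : seq 'rV[int]_n) (c : R) : set 'rV[R]_n :=
  if vs is v :: vs' then
    [set x | exists2 t, 0 <= t <= c & zon vs' c (x - t *: intvec R v)]
  else [set 0].

Lemma zonD n (vs : seq 'rV[int]_n) a b x y :
  zon vs a x -> zon vs b y -> zon vs (a + b) (x + y).
Proof.
elim: vs x y => [|v vs IH] x y /=; first by move=> -> ->; rewrite addr0.
move=> [t /andP[t0 ta] xt] [s /andP[s0 sb] ys]; exists (t + s).
  by rewrite addr_ge0 ?lerD.
by rewrite scalerDl opprD addrACA; exact: IH.
Qed.

Lemma zonZ n (vs : seq 'rV[int]_n) s a x :
  0 <= s -> zon vs a x -> zon vs (s * a) (s *: x).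
Proof.
move=> s0; elim: vs x => [|v vs IH] x /=; first by move=> ->; rewrite scaler0.
move=> [t /andP[t0 ta] xt]; exists (s * t).
  by rewrite mulr_ge0 ?ler_wpM2l.
by rewrite -scalerA -scalerBr; exact: IH.
Qed.

Lemma zon0 n (vs : seq 'rV[int]_n) c : 0 <= c -> zon vs c 0.
Proof.
move=> c0; elim: vs => [|v vs IH] //=; exists 0; first by rewrite lexx.
by rewrite scale0r subr0.
Qed.

Lemma zon_mono n (vs : seq 'rV[int]_n) a b x : a <= b -> zon vs a x -> zon vs b x.
Proof.
move=> ab zx; have := zonD zx (@zon0 n vs (b - a) _).
by rewrite addr0 subrKC subr_ge0; apply.
Qed.

Lemma zonV n (vs : seq 'rV[int]_n) s a x :
  0 < s -> zon vs (s * a) (s *: x) -> zon vs a x.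
Proof.
move=> s0 /(zonZ (s := s^-1)); rewrite invr_ge0 ltW// => /(_ isT).
by rewrite mulrA mulVf ?gt_eqF// mul1r scalerA mulVf ?gt_eqF// scale1r.
Qed.

Lemma zon_conv n (vs : seq 'rV[int]_n) c s x y :
  0 <= s <= 1 -> zon vs c x -> zon vs c y ->
  zon vs c (s *: x + (1 - s) *: y).
Proof.
move=> /andP[s0 s1] zx zy; have -> : c = s * c + (1 - s) * c by ring.
by apply: zonD; apply: zonZ => //; rewrite subr_ge0.
Qed.

Lemma intvecD n (u v : 'rV[int]_n) : intvec R (u + v) = intvec R u + intvec R v.
Proof. by rewrite /intvec map_mxD. Qed.
Lemma intvecB n (u v : 'rV[int]_n) : intvec R (u - v) = intvec R u - intvec R v.
Proof. by rewrite /intvec map_mxB. Qed.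
Lemma intvec0 n : intvec R (0 : 'rV[int]_n) = 0.
Proof. by apply/rowP => j; rewrite !mxE. Qed.
Lemma intvecZ n (k : int) (u : 'rV[int]_n) : intvec R (k *: u) = k%:~R *: intvec R u.
Proof. by apply/rowP => j; rewrite !mxE rmorphM. Qed.
Lemma intvecMn n (k : nat) (u : 'rV[int]_n) : intvec R (u *+ k) = k%:R *: intvec R u.
Proof. by apply/rowP => j; rewrite !mxE mulmxnE rmorphMn/= mulr_natl. Qed.
Lemma intvec_mul n n' (u : 'rV[int]_n) (U : 'M[int]_(n, n')) :
  intvec R (u *m U) = intvec R u *m map_mx intr U.
Proof. by rewrite /intvec map_mxM. Qed.
Lemma intvec_inj n : injective (@intvec R n).
Proof. by move=> u v /rowP uv; apply/rowP => j; have := uv j; rewrite !mxE => /intr_inj. Qed.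

(** [C] is a linear form. The difference of two points is a combination of the generators with
    coefficients in [[-c, c]]. Coordinate forms yield boundedness, cofactor columns yield bounds on
    determinants. *)
Lemma zon_abs n (vs : seq 'rV[int]_n) (C : 'cV[R]_n) c x y :
  zon vs c x -> zon vs c y ->
  `|((x - y) *m C) 0 0| <= c * \sum_(v <- vs) `|(intvec R v *m C) 0 0|.
Proof.
elim: vs x y => [|v vs IH] x y /=.
  by move=> -> ->; rewrite big_nil mulr0 subr0 mul0mx mxE normr0.
move=> [t t0 xt] [s s0 ys]; have H := IH _ _ xt ys.
have -> : x - y = ((x - t *: intvec R v) - (y - s *: intvec R v)) + (t - s) *: intvec R v.
  by apply/rowP => j; rewrite !mxE; ring.
rewrite mulmxDl mxE big_cons mulrDr (addrC (c * _)) (le_trans (ler_normD _ _))// lerD//.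
rewrite -scalemxAl mxE normrM ler_wpM2r//.
move: t0 s0 => /andP[t0 tc] /andP[s0 sc].
by rewrite ler_norml; apply/andP; split; lra.
Qed.

Lemma zon_bound n (vs : seq 'rV[int]_n) :
  exists2 M : nat, (0 < M)%N &
  forall c x y, zon vs c x -> zon vs c y -> 0 <= c ->
    forall j, `|(x - y) 0 j| <= c * M%:R.
Proof.
exists (\sum_(v <- vs) \sum_j `|v 0%R j|%N).+1 => // c x y zx zy c0 j.
have := zon_abs (\col_k (k == j)%:R) zx zy.
have E (z : 'rV[R]_n) : (z *m (\col_k (k == j)%:R)) 0 0 = z 0 j.
  rewrite mxE (bigD1 j)//= big1 ?addr0 ?mxE ?eqxx ?mulr1// => k kj.
  by rewrite !mxE (negPf kj) mulr0.
rewrite E => /le_trans; apply; apply: ler_wpM2l => //.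
rewrite -natr1 ler_wpDr// natr_sum; apply: ler_sum => v _ /=.
rewrite E mxE natr_sum (bigD1 j)//= ler_wpDr ?sumr_ge0//.
by rewrite -intr_norm natr_absz.
Qed.

Lemma zon_map n n' (vs : seq 'rV[int]_n) (U : 'M[int]_(n, n')) c x :
  zon vs c x -> zon [seq v *m U | v <- vs] c (x *m map_mx intr U).
Proof.
elim: vs x => [|v vs IH] x /=; first by move=> ->; rewrite mul0mx.
move=> [t t0 xt]; exists t => //.
by rewrite intvec_mul scalemxAl -mulmxBl; exact: IH.
Qed.

Lemma zon_map_inv n n' (vs : seq 'rV[int]_n) (U : 'M[int]_(n, n')) c y :
  zon [seq v *m U | v <- vs] c y -> exists2 x, zon vs c x & y = x *m map_mx intr U.
Proof.
elim: vs y => [|v vs IH] y /=; first by move=> ->; exists 0 => //; rewrite mul0mx.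
move=> [t t0 /IH[x zx e]]; exists (x + t *: intvec R v).
  by exists t => //; rewrite addrK.
by rewrite mulmxDl -e -scalemxAl -intvec_mul subrK.
Qed.

Lemma zon_unimod n (vs : seq 'rV[int]_n) (U : 'M[int]_n) c (z : 'rV[int]_n) :
  U \in unitmx ->
  zon [seq v *m U | v <- vs] c (intvec R (z *m U)) <-> zon vs c (intvec R z).
Proof.
move=> uU; split; last by rewrite intvec_mul; exact: zon_map.
move=> /zon_map_inv[x zx]; rewrite intvec_mul => /(congr1 (mulmx^~ (map_mx intr (invmx U)))).
by rewrite -!mulmxA -map_mxM/= mulmxV// map_mx1 !mulmx1 => ->.
Qed.

Lemma zon_unimodB n (vs : seq 'rV[int]_n) (U : 'M[int]_n) c x y (z : 'rV[int]_n) :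
  U \in unitmx ->
  zon [seq v *m U | v <- vs] c x -> zon [seq v *m U | v <- vs] c y ->
  intvec R z = x - y ->
  exists a b, [/\ zon vs c a, zon vs c b & intvec R (z *m invmx U) = a - b].
Proof.
move=> uU /zon_map_inv[a za ->] /zon_map_inv[b zb ->] e.
exists a, b; split=> //; rewrite intvec_mul e -mulmxBl -mulmxA -map_mxM/=.
by rewrite mulmxV// map_mx1 mulmx1.
Qed.

Definition boxseq (n M : nat) : seq 'rV[int]_n :=
  [seq \row_j ((val (f j))%:Z - M%:Z) | f : {ffun 'I_n -> 'I_(M + M).+1}].

Lemma boxseqP n M (z : 'rV[int]_n) :
  (forall j, `|z 0 j| <= M%:Z) -> z \in boxseq n M.
Proof.
move=> zM; apply/mapP; exists [ffun j => inord `|(z ord0 j + M%:Z)%R|%N].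
  by rewrite mem_enum.
apply/rowP => j; rewrite mxE ffunE/= inordK; move: (zM j); move: (z _ j) => a; lia.
Qed.

Definition zonbd n (vs : seq 'rV[int]_n) : nat := projT1 (cid2 (zon_bound vs)).

(** Boundedness allows the lattice points to be filtered out of a large box, so that counting them
    is taking the length of a duplicate-free list. *)
Definition latpts n (vs : seq 'rV[int]_n) (c : R) : seq 'rV[int]_n :=
  undup [seq z <- boxseq n (Num.truncn (c * (zonbd vs)%:R)).+1 | `[< zon vs c (intvec R z) >]].

Lemma latpts_uniq n (vs : seq 'rV[int]_n) c : uniq (latpts vs c).
Proof. exact: undup_uniq. Qed.

Lemma mem_latpts n (vs : seq 'rV[int]_n) c z :
  0 <= c -> z \in latpts vs c <-> zon vs c (intvec R z).
Proof.
move=> c0; rewrite mem_undup mem_filter; split; first by move=> /andP[/asboolP].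
move=> zz; apply/andP; split; first exact/asboolP.
apply: boxseqP => j; rewrite /zonbd; case: cid2 => M M0 /= H.
have := H _ _ _ zz (zon0 vs c0) c0 j; rewrite subr0 mxE => H1.
rewrite -(ler_int R) intr_norm (le_trans H1)// ltW//.
by rewrite -pmulrn; apply: truncnS_gt.
Qed.

End Zon.

(** * Sums over subfamilies, integral determinants and minimal completions *)

Section Sums.
Variables (R : numDomainType) (T : eqType).
Implicit Types (vs S : seq T) (W : seq T -> R).

(** The recursion is that of deletion and contraction. Members are chosen by position, so equal
    vectors count separately. *)
Fixpoint subsum vs i W : R :=
  if vs is v :: vs' then
    subsum vs' i W + (if i is i'.+1 then subsum vs' i' (fun S => W (v :: S)) else 0)
  else if i is 0 then W [::] else 0.

Fixpoint tupsum vs i W : R :=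
  if i is i'.+1 then \sum_(x <- vs) tupsum vs i' (fun S => W (x :: S)) else W [::].

Lemma subsum_le vs i W W' :
  (forall S, size S = i -> {subset S <= vs} -> W S <= W' S) ->
  subsum vs i W <= subsum vs i W'.
Proof.
elim: vs i W W' => [|v vs IH] [|i] W W' le //=.
- exact: le.
- by rewrite !addr0; apply: IH => S sS ss; apply: le => // x /ss; rewrite inE orbC => ->.
apply: lerD.
  by apply: IH => S sS ss; apply: le => // x /ss; rewrite inE orbC => ->.
apply: IH => S sS ss; apply: le => /=; first by rewrite sS.
by move=> x; rewrite !inE => /orP[->//|/ss ->]; rewrite orbT.
Qed.

Lemma subsum_eq vs i W W' :
  (forall S, size S = i -> {subset S <= vs} -> W S = W' S) ->
  subsum vs i W = subsum vs i W'.
Proof. by move=> e; apply/le_anti; rewrite !subsum_le// => S sS ss; rewrite e. Qed.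

Lemma subsum0 vs i : subsum vs i (fun=> 0) = 0.
Proof. by elim: vs i => [|v vs IH] [|i] //=; rewrite ?addr0 ?IH ?addr0. Qed.

Lemma subsum_ge0 vs i W : (forall S, 0 <= W S) -> 0 <= subsum vs i W.
Proof. by move=> W0; rewrite -(subsum0 vs i) subsum_le. Qed.

Lemma subsumZ vs i c W : subsum vs i (fun S => c * W S) = c * subsum vs i W.
Proof.
by elim: vs i W => [|v vs IH] [|i] W //=; rewrite ?mulr0 ?addr0 ?IH// mulrDr.
Qed.

Lemma tupsum_le vs i W W' :
  (forall S, size S = i -> W S <= W' S) -> tupsum vs i W <= tupsum vs i W'.
Proof.
elim: i W W' => [|i IH] W W' le /=; first exact: le.
by apply: ler_sum => x _; apply: IH => S sS; apply: le; rewrite /= sS.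
Qed.

Lemma tupsum_eq vs i W W' :
  (forall S, size S = i -> W S = W' S) -> tupsum vs i W = tupsum vs i W'.
Proof. by move=> e; apply/le_anti; rewrite !tupsum_le// => S sS; rewrite e. Qed.

Lemma tupsum0 vs i W : (forall S, size S = i -> W S = 0) -> tupsum vs i W = 0.
Proof.
elim: i W => [|i IH] W le /=; first exact: le.
by rewrite big1// => x _; apply: IH => S sS; apply: le; rewrite /= sS.
Qed.

Lemma tupsum_ge0 vs i W : (forall S, 0 <= W S) -> 0 <= tupsum vs i W.
Proof. by elim: i W => [|i IH] W W0 //=; apply: sumr_ge0 => x _; apply: IH. Qed.

Lemma tupsum_cat vs i j W :
  tupsum vs (i + j) W = tupsum vs i (fun S => tupsum vs j (fun S' => W (S ++ S'))).
Proof. by elim: i W => [|i IH] W //=; apply: eq_bigr => x _; rewrite IH. Qed.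

Lemma tupsum_cons_absent v vs i W :
  (forall S, size S = i -> v \in S -> W S = 0) ->
  tupsum (v :: vs) i W = tupsum vs i W.
Proof.
elim: i W => [|i IH] W W0 //=; rewrite big_cons tupsum0 ?add0r.
  apply: eq_bigr => x _; apply: IH => S sS vS; apply: W0; first by rewrite /= sS.
  by rewrite inE vS orbT.
by move=> S sS; apply: W0; rewrite /= ?sS// mem_head.
Qed.

(** These are the properties of the absolute value of a determinant as a function of its list of
    rows. *)
Definition sym_alt i W :=
  (forall S S', size S = i -> perm_eq S S' -> W S = W S') /\
  (forall S, size S = i -> ~~ uniq S -> W S = 0).

Lemma sym_alt_cons i W x : sym_alt i.+1 W -> sym_alt i (fun S => W (x :: S)).
Proof.
move=> [s a]; split=> [S S' sS p|S sS u].
  by apply: s; rewrite /= ?sS// perm_cons.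
by apply: a; rewrite /= ?sS// (negPf u) andbF.
Qed.

(** A contributing tuple uses the new entry at most once, and symmetry moves it to the front from
    any of the [i] positions. *)
Lemma tupsum_cons v vs i W : sym_alt i W ->
  tupsum (v :: vs) i W = tupsum vs i W +
    (if i is i'.+1 then i%:R * tupsum vs i' (fun S => W (v :: S)) else 0).
Proof.
elim: i W => [|i IH] W sa /=; first by rewrite addr0.
rewrite big_cons tupsum_cons_absent; last first.
  move=> S sS vS; apply: sa.2; first by rewrite /= sS.
  by rewrite /= vS.
rewrite (eq_bigr _ (fun x _ => IH _ (sym_alt_cons x sa))).
rewrite big_split/= addrCA; congr (_ + _).
case: i IH sa => [|i] _ sa /=; first by rewrite big1// addr0 mul1r.
rewrite -mulr_sumr -[i.+2%:R]natr1 mulrDl mul1r addrC; congr (_ * _ + _).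
apply: eq_bigr => x _; apply: tupsum_eq => S sS; apply: sa.1; rewrite /= ?sS//.
by apply/permP => p /=; rewrite addnCA.
Qed.

(** Each subfamily is listed by [i!] tuples; [tupsum_cons] turns this into an induction parallel to
    the recursion of [subsum]. *)
Lemma tupsum_subsum vs i W : sym_alt i W -> tupsum vs i W = i`!%:R * subsum vs i W.
Proof.
elim: vs i W => [|v vs IH] [|i] W sa /=.
- by rewrite mul1r.
- by rewrite big_nil mulr0.
- by rewrite addr0; exact: (IH 0%N W sa).
have /= -> := @tupsum_cons v vs i.+1 W sa.
have /= -> := IH i.+1 W sa; rewrite mulrDr IH; last exact: sym_alt_cons.
by rewrite factS natrM !mulrA.
Qed.

End Sums.

Lemma subsum_map (R : numDomainType) (T T' : eqType) (f : T -> T') vs i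
    (W : seq T' -> R) :
  subsum (map f vs) i W = subsum vs i (fun S => W (map f S)).
Proof. by elim: vs i W => [|v vs IH] [|i] W //=; rewrite ?IH. Qed.

(** * Determinants of lists of integral vectors, projection along [e_1], and minimal completions *)

Section Det.

(** Lists avoid dependent types when families are extended; a short list is padded with zero rows
    and a long one is truncated. *)
Definition detl (n : nat) (S : seq 'rV[int]_n) : int :=
  \det (\matrix_(i < n, j < n) (nth 0 S i) 0 j).

Lemma detl_mul n (S : seq 'rV[int]_n) (U : 'M[int]_n) :
  detl [seq v *m U | v <- S] = detl S * \det U.
Proof.
rewrite /detl -det_mulmx; congr (\det _); apply/matrixP => i j; rewrite !mxE.
have -> : nth 0 [seq v *m U | v <- S] i = nth 0 S i *m U.
  have [iS|iS] := ltnP i (size S); first by rewrite (nth_map 0).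
  by rewrite !nth_default ?size_map// mul0mx.
by rewrite mxE; apply: eq_bigr => k _; rewrite !mxE.
Qed.

Lemma detl_alt n (S : seq 'rV[int]_n) : size S = n -> ~~ uniq S -> detl S = 0.
Proof.
move=> sS /(uniqPn 0)[i [j [ij jS e]]]; rewrite sS in jS.
apply: (@determinant_alternate _ _ _ (Ordinal (ltn_trans ij jS)) (Ordinal jS)).
  by rewrite -val_eqE/= neq_ltn ij.
by move=> k; rewrite !mxE/= e.
Qed.

Lemma detl_perm n (S S' : seq 'rV[int]_n) :
  size S = n -> perm_eq S S' -> `|detl S|%N = `|detl S'|%N.
Proof.
move=> sS; have sSb : size S == n by rewrite sS.
rewrite perm_sym => p; have sS' : size S' == n by rewrite (perm_size p) sS.
have /perm.tuple_permP[s e] : perm_eq S' (Tuple sSb) by [].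
have -> : detl S' = (-1) ^+ perm.odd_perm s * detl S.
  rewrite /detl -det_perm -det_mulmx -row_permE; congr (\det _).
  apply/matrixP => i j; rewrite !mxE e.
  by rewrite (nth_map i) ?size_enum_ord// nth_ord_enum (tnth_nth 0).
by rewrite abszM abszX/= exp1n mul1n.
Qed.

Lemma detl_sym_alt (R : numDomainType) n :
  sym_alt n (fun S : seq 'rV[int]_n => `|detl S|%:R : R).
Proof.
split=> [S S' sS p|S sS u]; first by rewrite (detl_perm sS p).
by rewrite (detl_alt sS u).
Qed.

(** The coefficients are the cofactors along row [size S]. They do not involve that row, so they may
    be computed with [0] in place of [u]. *)
Lemma detl_linear n (S S' : seq 'rV[int]_n) : (size S < n)%N ->
  exists C : 'cV[int]_n, forall u, detl (S ++ u :: S') = (u *m C) 0 0.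
Proof.
move=> sS; pose i0 := Ordinal sS.
pose M u : 'M[int]_n := \matrix_(i < n, j < n) (nth 0 (S ++ u :: S') i) 0 j.
exists (\col_j cofactor (M 0) i0 j) => u; rewrite mxE /detl (expand_det_row _ i0).
apply: eq_bigr => j _; rewrite !mxE nth_cat ltnn subnn/=; congr (_ * _).
rewrite /cofactor; congr (_ * \det _); apply/matrixP => a b; rewrite !mxE.
rewrite !nth_cat; case: ltnP => // le /=.
have : (lift i0 a : nat) != size S by rewrite eq_sym; exact: (neq_lift i0 a).
by case: (_ - _)%N (subnKC le) => //= <-; rewrite addn0 eqxx.
Qed.

(** Multiplying a row vector by this matrix forgets its first coordinate, which is contraction along
    [e_1]; the transpose reinserts a zero. *)
Definition proj0 n : 'M[int]_(n.+1, n) := \matrix_(i, j) (i == lift 0 j)%:R.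

Lemma mul_proj0 (n : nat) (v : 'rV[int]_n.+1) j : (v *m proj0 n) 0 j = v 0 (lift 0 j).
Proof.
rewrite mxE (bigD1 (lift 0 j))//= !mxE eqxx mulr1 big1 ?addr0// => k kj.
by rewrite !mxE (negPf kj) mulr0.
Qed.

Lemma mul_proj0T n (v : 'rV[int]_n) : v *m (proj0 n)^T *m proj0 n = v.
Proof.
apply/rowP => j; rewrite mul_proj0 mxE (bigD1 j)//= !mxE eqxx mulr1 big1 ?addr0// => k kj.
by rewrite !mxE (inj_eq lift_inj) eq_sym (negPf kj) mulr0.
Qed.

Lemma mul_proj0T0 n (v : 'rV[int]_n) : (v *m (proj0 n)^T) 0 0 = 0.
Proof. by rewrite mxE big1// => k _; rewrite !mxE (negPf (neq_lift _ _)) mulr0. Qed.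

Lemma mul_proj0TE n (v : 'rV[int]_n) j : (v *m (proj0 n)^T) 0 (lift 0 j) = v 0 j.
Proof. by rewrite -mul_proj0 mul_proj0T. Qed.

Lemma proj0_split n (z : 'rV[int]_n.+1) :
  z = z 0 0 *: delta_mx 0 0 + z *m proj0 n *m (proj0 n)^T.
Proof.
apply/rowP => j; have [j0|] := unliftP 0 j; last first.
  by move=> ->; rewrite mxE mul_proj0T0 !mxE !eqxx mulr1 addr0.
move=> ->; rewrite [RHS]mxE mul_proj0TE mul_proj0 !mxE.
by rewrite (eq_sym (lift _ _)) (negPf (neq_lift _ _)) mulr0 add0r.
Qed.

Lemma detl_delta n (d : int) (S : seq 'rV[int]_n.+1) :
  detl (d *: delta_mx 0 0 :: S) = d * detl [seq v *m proj0 n | v <- S].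
Proof.
rewrite /detl (expand_det_row _ 0) (bigD1 0)//= big1 ?addr0; last first.
  by move=> j j0; rewrite !mxE (negPf j0) mulr0 mul0r.
rewrite !mxE !eqxx mulr1; congr (_ * _); rewrite /cofactor expr0 mul1r.
congr (\det _); apply/matrixP => a b; rewrite !mxE/=.
have [aS|aS] := ltnP a (size S); first by rewrite (nth_map 0)// mul_proj0.
by rewrite (nth_default _ aS) nth_default ?size_map// !mxE.
Qed.

Definition completes n (S : seq 'rV[int]_n) (a : nat) : Prop :=
  exists w, [/\ size (S ++ w) = n, detl (S ++ w) != 0 & a = `|detl (S ++ w)|%N].

(** For independent [S] this is the index of the lattice generated by [S] in the lattice of all
    integral points of its span. The value is [0] when no completion exists. *)
Definition mincompl n (S : seq 'rV[int]_n) : nat :=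
  if pselect (exists a, `[< completes S a >]) is left e then ex_minn e else 0.

Lemma mincomplP n (S : seq 'rV[int]_n) a :
  completes S a -> completes S (mincompl S) /\ (mincompl S <= a)%N.
Proof.
move=> c; rewrite /mincompl; case: pselect => [e|[]]; last by exists a; apply/asboolP.
by case: ex_minnP => b /asboolP cb H; split=> //; apply: H; apply/asboolP.
Qed.

Lemma mincompl_neq0 n (S : seq 'rV[int]_n) :
  (mincompl S == 0%N) = false -> completes S (mincompl S).
Proof.
rewrite /mincompl; case: pselect => [e|//].
by case: ex_minnP => b /asboolP.
Qed.

Lemma unimod_absdet n (U : 'M[int]_n) : U \in unitmx -> `|\det U|%N = 1%N.
Proof. by rewrite unitmxE => /orP[] /eqP ->. Qed.

Lemma map_mulmxK n (S : seq 'rV[int]_n) (U V : 'M[int]_n) :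
  U *m V = 1%:M -> [seq v *m V | v <- [seq v *m U | v <- S]] = S.
Proof.
by move=> e; rewrite -map_comp -[RHS]map_id; apply: eq_map => v /=; rewrite -mulmxA e mulmx1.
Qed.

Lemma completes_unimod n (S : seq 'rV[int]_n) (U : 'M[int]_n) a :
  U \in unitmx -> completes S a -> completes [seq v *m U | v <- S] a.
Proof.
move=> uU [w [sw dw ->]]; exists [seq v *m U | v <- w].
rewrite -map_cat size_map detl_mul mulf_eq0 negb_or dw abszM unimod_absdet//= muln1.
by split=> //; rewrite -absz_eq0 unimod_absdet.
Qed.

Lemma mincompl_unimod n (S : seq 'rV[int]_n) (U : 'M[int]_n) :
  U \in unitmx -> (mincompl [seq v *m U | v <- S] <= mincompl S)%N.
Proof.
move=> uU; case E : (mincompl [seq v *m U | v <- S] == 0%N); first by rewrite (eqP E).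
have /(completes_unimod (U := invmx U)) := mincompl_neq0 E.
rewrite unitmx_inv map_mulmxK ?mulmxV// => /(_ uU)/mincomplP[+ _].
by move=> /(completes_unimod uU)/mincomplP[].
Qed.

(** Expanding along the row [d e_1], a completion of the whole family projects to a completion of
    the projected one, with the determinant divided by [d]. *)
Lemma mincompl_delta n (d : nat) (S : seq 'rV[int]_n.+1) : (0 < d)%N ->
  (d * mincompl [seq v *m proj0 n | v <- S] <= mincompl (d%:Z *: delta_mx 0 0 :: S)%R)%N.
Proof.
move=> d0; case E : (mincompl [seq v *m proj0 n | v <- S] == 0%N).
  by rewrite (eqP E) muln0.
have [w [sw dw _]] := mincompl_neq0 E.
have dn : d%:Z != 0 by rewrite -lt0n in d0 *; case: d d0.
pose S1 := d%:Z *: delta_mx 0 0 :: S.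
(* Lifting [w] back shows that the family [S1] has a completion, so its [mincompl] is attained and
   is not the default [0]. *)
have [] : completes S1 (mincompl S1) /\
    (mincompl S1 <= `|detl (S1 ++ [seq v *m (proj0 n)^T | v <- w])|)%N.
  apply: mincomplP; exists [seq v *m (proj0 n)^T | v <- w]; split=> //=.
    by move: sw; rewrite !size_cat !size_map => ->.
  rewrite /S1 detl_delta mulf_neq0// map_cat -map_comp.
  by rewrite (_ : map _ w = w)// -[RHS]map_id; apply: eq_map => v /=; rewrite mul_proj0T.
rewrite -/S1; move=> [w' [/= [sw'] dw' ->]] _; rewrite detl_delta abszM/= leq_mul2l.
apply/orP; right; move: dw'; rewrite detl_delta mulf_eq0 negb_or map_cat => /andP[_ dw'].
apply: (mincomplP _).2; exists [seq v *m proj0 n | v <- w']; split=> //.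
by rewrite -map_cat size_map.
Qed.

End Det.

(** * The Ehrhart polynomial by deletion and contraction *)

Lemma int_max (P : int -> Prop) (m0 B : int) :
  P m0 -> (forall m, P m -> m <= B) ->
  exists2 m, P m & forall m', P m' -> m' <= m.
Proof.
move=> P0 PB; pose Q n := `[< P (m0 + n%:Z) >].
have eQ : exists n, Q n by exists 0%N; apply/asboolP; rewrite addr0.
have bQ n : Q n -> (n <= `|B - m0|)%N by move=> /asboolP/PB; lia.
case: (ex_maxnP eQ bQ) => n /asboolP Pn Hn; exists (m0 + n%:Z) => // m' Pm'.
have [le|lt] := leP m' m0; first by lia.
have : Q `|m' - m0|%N by apply/asboolP; rewrite (_ : m0 + _ = m')//; lia.
by move=> /Hn; lia.
Qed.

(** This is the Smith normal form of a single row, with the sign of its only invariant absorbed into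
    [U]. *)
Lemma smith_row (n : nat) (v : 'rV[int]_n.+1) : v != 0 ->
  exists (U : 'M[int]_n.+1) (d : nat),
    [/\ U \in unitmx, (0 < d)%N & v *m U = d%:Z *: delta_mx 0 0].
Proof.
move=> v0; have [L uL [V uV [s _ e]]] := int_Smith_normal_form v.
have eU : v *m invmx V = (\det L * s`_0) *: delta_mx 0 0.
  rewrite e mulmxK// (mx11_scalar L) det_scalar1 mul_scalar_mx; apply/rowP => j.
  by rewrite !mxE eqxx/= eq_sym -mulrA mulr_natr.
have d0 : \det L * s`_0 != 0.
  apply: contraNneq v0 => d0; rewrite d0 scale0r in eU.
  by rewrite -(mulmxKV uV v) eU mul0mx.
set d := \det L * _ in eU d0.
exists (Num.sg d *: invmx V), `|d|%N; split.
- have [dp|dn] := ltrP 0 d; first by rewrite gtr0_sg// scale1r unitmx_inv.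
  by rewrite ltr0_sg ?lt_neqAle ?d0// scaleN1r unitmxE -scaleN1r detZ unitrM 
    unitrX ?unitrN1// -unitmxE unitmx_inv.
- by rewrite absz_gt0.
- by rewrite -scalemxAr eU scalerA -normrEsg abszE.
Qed.

Section Ehrhart.
Variable R : realType.
Local Notation latpts := (@latpts R _).

Lemma size_latpts_unimod n (vs : seq 'rV[int]_n) (U : 'M[int]_n) (c : R) :
  0 <= c -> U \in unitmx ->
  size (latpts [seq v *m U | v <- vs] c) = size (latpts vs c).
Proof.
move=> c0 uU; rewrite -(size_map (mulmx^~ U) (latpts vs c)); apply/perm_size/uniq_perm.
- exact: latpts_uniq.
- by rewrite map_inj_uniq ?latpts_uniq//; apply: can_inj (mulmxK uU).
move=> z; apply/idP/mapP.
  move=> /(mem_latpts _ _ c0) zz; exists (z *m invmx U); last by rewrite mulmxKV.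
  by apply/(mem_latpts _ _ c0)/(zon_unimod _ _ _ uU); rewrite mulmxKV.
by move=> [y /(mem_latpts _ _ c0) zy ->]; apply/(mem_latpts _ _ c0)/(zon_unimod _ _ _ uU).
Qed.

(* On each line parallel to e_1 the section of the zonotope is an interval, and adding the
   segment [0, k d e_1] lengthens it by k d, so it gains exactly k d lattice points. *)
Lemma size_latpts_cons n (vs : seq 'rV[int]_n.+1) (d k : nat) :
  size (latpts (d%:Z *: delta_mx 0 0 :: vs) k%:R) =
  (size (latpts vs k%:R) + k * d * size (latpts [seq v *m proj0 n | v <- vs] k%:R))%N.
Proof.
have k0 : 0 <= k%:R :> R by [].
pose pt (m : int) (y : 'rV[int]_n) : 'rV[int]_n.+1 := m *: delta_mx 0 0 + y *m (proj0 n)^T.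
have pt0 m y : pt m y 0 0 = m by rewrite mxE mul_proj0T0 !mxE !eqxx mulr1 addr0.
have ptp m y : pt m y *m proj0 n = y.
  rewrite mulmxDl mul_proj0T -scalemxAl (_ : delta_mx 0 0 *m _ = 0) ?scaler0 ?add0r//.
  by apply/rowP => j; rewrite mul_proj0 !mxE eq_sym (negPf (neq_lift _ _)).
pose ptR (a : R) y := a *: intvec R (delta_mx 0 0) + intvec R (y *m (proj0 n)^T).
have ptE m y : intvec R (pt m y) = ptR m%:~R y by rewrite intvecD intvecZ.
have ptR_0 a y : ptR a y 0 0 = a.
  by rewrite mxE [X in _ + X]mxE mul_proj0T0 !mxE !eqxx/= mulr1 addr0.
have ptR_l a y j : ptR a y 0 (lift 0 j) = (y 0 j)%:~R.
  rewrite mxE [X in _ + X]mxE mul_proj0TE !mxE.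
  by rewrite eqxx/= mulr0 add0r.
have ptRconv a b c y : zon vs k%:R (ptR a y) -> zon vs k%:R (ptR c y) ->
    a <= b <= c -> zon vs k%:R (ptR b y).
  move=> za zc /andP[ab bc]; have [ac|ac] := eqVneq a c.
    by have -> : b = a by apply/le_anti; rewrite ab ac bc.
  have lac : 0 < c - a by rewrite subr_gt0 lt_neqAle ac (le_trans ab bc).
  pose s := (c - b) / (c - a).
  have := @zon_conv _ _ vs k%:R s _ _ _ za zc.
  have -> : s *: ptR a y + (1 - s) *: ptR c y = ptR b y.
    rewrite /ptR !scalerDr addrACA -scalerDl subrKC scale1r !scalerA -scalerDl.
    by congr (_ *: _ + _); rewrite /s; field; rewrite gt_eqF.
  apply; rewrite /s ler_pdivrMr// mul1r lerD2l lerN2 ab andbT.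
  by rewrite divr_ge0 ?subr_ge0 ?(le_trans ab).
(* The integer [m] is the floor of the upper end of the section over [y]. The point [pt m y] itself
   may miss the zonotope when the section contains no integer. *)
have exM y : y \in latpts [seq v *m proj0 n | v <- vs] k%:R ->
    exists m : int, (exists2 a, m%:~R <= a & zon vs k%:R (ptR a y)) /\
      (forall m' : int, (exists2 a, m'%:~R <= a & zon vs k%:R (ptR a y)) -> m' <= m).
  move=> /(mem_latpts _ _ k0)/zon_map_inv[x zx ex].
  have xE : x = ptR (x 0 0) y.
    apply/rowP => j; have [j1|] := unliftP 0 j; last first.
      by move=> ->; rewrite ptR_0.
    move=> ->; rewrite ptR_l; move/rowP/(_ j1) : ex; rewrite [LHS]mxE => ->.
    rewrite mxE (bigD1 (lift 0 j1))//= big1 ?addr0; first by rewrite !mxE eqxx mulr1.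
    by move=> i ij; rewrite !mxE (negPf ij) mulr0.
  rewrite xE in zx.
  have [M M0 HM] := zon_bound R vs.
  case: (@int_max (fun m : int => exists2 a, m%:~R <= a & zon vs k%:R (ptR a y))
     (Num.floor (x 0 0)) (Num.ceil (k%:R * M%:R : R))) => [||m Pm Hm]; last by exists m.
    by exists (x 0 0) => //; exact: floor_le.
  move=> m [a ma za]; rewrite -(ler_int R) (le_trans ma)//.
  have := HM _ _ _ za (zon0 vs k0) k0 0; rewrite subr0 ptR_0.
  by move=> /(le_trans (ler_norm _))/le_trans; apply; exact: ceil_ge.
pose M y := if pselect (y \in latpts [seq v *m proj0 n | v <- vs] k%:R) is left h
            then projT1 (cid (exM y h)) else 0.
have MP y : y \in latpts [seq v *m proj0 n | v <- vs] k%:R ->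
   (exists2 a, (M y)%:~R <= a & zon vs k%:R (ptR a y)) /\
      (forall m' : int, (exists2 a, m'%:~R <= a & zon vs k%:R (ptR a y)) -> m' <= M y).
  by move=> h; rewrite /M; case: pselect => // h'; case: cid.
have zonE z : zon (d%:Z *: delta_mx 0 0 :: vs) k%:R (intvec R z) <->
   exists2 t : R, 0 <= t <= (k * d)%:R & zon vs k%:R (ptR ((z 0 0)%:~R - t) (z *m proj0 n)).
  have E t : intvec R z - t *: intvec R (delta_mx 0 0) = ptR ((z 0 0)%:~R - t) (z *m proj0 n).
    by rewrite {1}(proj0_split z) intvecD intvecZ addrAC -scalerBl.
  split=> /=.
    move=> [t /andP[t0 tk]]; rewrite intvecZ scalerA E => zt; exists (t * d%:R) => //.
    by rewrite mulr_ge0// natrM ler_wpM2r.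
  move=> [t /andP[t0 tk] zt]; have [dz|dz] := eqVneq d 0%N.
    exists 0; first by rewrite lexx.
    rewrite scale0r; have {}t0 : t = 0 by apply/le_anti; rewrite t0 (le_trans tk)// dz muln0.
    by move: zt; rewrite -E t0 scale0r.
  have d0 : 0 < d%:R :> R by rewrite ltr0n lt0n.
  exists (t / d%:R); first by rewrite divr_ge0// ler_pdivrMr// -natrM.
  by rewrite intvecZ scalerA divfK ?gt_eqF// E.
(* The new points over [y] are the [k * d] integers directly above [M y], whether or not the old
   section contained a lattice point. *)
pose f y j := pt (M y + (j : nat).+1%:Z) y.
rewrite -(size_iota 0 (k * d)) mulnC -(size_allpairs f) -size_cat.
apply/perm_size/uniq_perm; first exact: latpts_uniq.
  rewrite cat_uniq latpts_uniq/=; apply/andP; split.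
    apply/hasPn => z /allpairsP[[y j] /= [yl _ ->]]; apply/negP => /(mem_latpts _ _ k0).
    rewrite /f ptE => zz; suff : M y + j.+1%:Z <= M y by lia.
    by apply: (MP y yl).2; eexists; [exact: lexx|exact: zz].
  apply: allpairs_uniq; rewrite ?latpts_uniq ?iota_uniq// => -[y j] [y' j'] /= _ _ e.
  have ey : y = y' by rewrite -(ptp (M y + j.+1%:Z) y) -/(f y j) e /f ptp.
  have := congr1 (fun z : 'rV_n.+1 => z 0 0) e; rewrite /f !pt0 -ey => ej; congr (_, _) => //.
  lia.
move=> z; have zpt : z = pt (z 0 0) (z *m proj0 n) by exact: proj0_split.
rewrite mem_cat; apply/idP/orP.
  move=> /(mem_latpts _ _ k0)/zonE[t /andP[t0 tk] zt].
  have yl : z *m proj0 n \in latpts [seq v *m proj0 n | v <- vs] k%:R.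
    apply/(mem_latpts _ _ k0); have := zon_map (proj0 n) zt; congr (zon _ _ _).
    rewrite mulmxDl -intvec_mul mul_proj0T -scalemxAl -intvec_mul.
    rewrite (_ : delta_mx 0 0 *m _ = 0) ?intvec0 ?scaler0 ?add0r//.
    by apply/rowP => j; rewrite mul_proj0 !mxE eq_sym (negPf (neq_lift _ _)).
  have [[a Ma za] maxM] := MP _ yl.
  have [zM|zM] := leP (z 0 0) (M (z *m proj0 n)).
    left; apply/(mem_latpts _ _ k0); rewrite zpt ptE; apply: ptRconv zt za _.
    by rewrite gerBl t0/= (le_trans _ Ma)// ler_int.
  pose u := z 0 0 - M (z *m proj0 n) - 1.
  right; apply/allpairsP; exists (z *m proj0 n, `|u|%N) => /=.
  have : z 0 0 - (k * d)%:Z <= M (z *m proj0 n).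
    apply: maxM; exists ((z 0 0)%:~R - t) => //.
    by rewrite rmorphB/= lerB// -pmulrn.
  rewrite mem_iota /f => le; split=> //; first by rewrite /u; lia.
  by rewrite {1}zpt; congr pt; rewrite /u; lia.
case.
  move=> /(mem_latpts _ _ k0) zz; apply/(mem_latpts _ _ k0)/zonE; exists 0.
    by rewrite lexx/=.
  by rewrite subr0 -ptE -zpt.
move=> /allpairsP[[y j] /= [yl + ->]]; rewrite mem_iota/= add0n => jk.
apply/(mem_latpts _ _ k0)/zonE; rewrite /f ptp pt0.
have [[a Ma za] maxM] := MP _ yl.
have aM : a < (M y + 1)%:~R.
  rewrite ltNge; apply/negP => h.
  suff : M y + 1 <= M y by lia.
  by apply: maxM; exists a.
exists ((M y + j.+1%:Z)%:~R - a); last by rewrite subKr.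
have : (j.+1%:R : R) <= (k * d)%:R by rewrite ler_nat.
move: aM; rewrite !rmorphD/= -!pmulrn -natr1 => aM jkd.
have j0 : 0 <= j%:R :> R by [].
by apply/andP; split; lra.
Qed.

(** By induction on the number of generators: a unimodular map makes a nonzero generator [d e_1],
    and [size_latpts_cons] adds [k d] times the polynomial of the contraction to that of the
    deletion. The sums over subfamilies obey the same recursion, by [mincompl_delta] and
    [detl_delta]. *)
Theorem ehrhart_zon n (vs : seq 'rV[int]_n) : exists c : nat -> R,
  [/\ forall i, 0 <= c i,
      forall k : nat, (size (latpts vs k%:R))%:R = \sum_(i < n.+1) c i * k%:R ^+ i,
      forall i, c i <= subsum vs i (fun S => (mincompl S)%:R) &
      c n = subsum vs n (fun S => `|detl S|%:R)].
Proof.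
move szv : (size vs) => m; elim: m n vs szv => [|m IH] n vs.
  move=> /size0nil {vs}->; exists (fun i => (i == 0%N)%:R); split=> [i|k|i|].
  - by [].
  - rewrite big_ord_recl/= mulr1 big1 ?addr0 => [|i _]; last by rewrite mul0r.
    congr (_%:R); apply/eqP; rewrite eqn_leq; apply/andP; split.
      have : {subset latpts ([::] : seq 'rV_n) k%:R <= [:: 0]}.
        move=> z /(mem_latpts _ _ (ler0n _ _))/= e; rewrite inE; apply/eqP/(@intvec_inj R).
        by rewrite intvec0.
      by move/(uniq_leq_size (latpts_uniq _ _)).
    rewrite -has_predT; apply/hasP; exists 0 => //.
    by apply/(mem_latpts _ _ (ler0n _ _)) => /=; rewrite intvec0.
  - case: i => //=; rewrite ler1n lt0n; apply/eqP => e0.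
    (* The standard basis completes the empty family with determinant [1], so its [mincompl] cannot
       be [0]. *)
    have : completes ([::] : seq 'rV[int]_n) 1%N.
      exists [seq delta_mx 0 j | j <- enum 'I_n]; rewrite size_map size_enum_ord.
      suff -> : detl [seq delta_mx 0 j | j <- enum 'I_n] = 1 by [].
      rewrite -(det1 _ n) /detl; congr (\det _); apply/matrixP => a b; rewrite !mxE.
      by rewrite (nth_map a) ?size_enum_ord// nth_ord_enum !mxE eqxx/= eq_sym.
    move=> /mincomplP[[w [_ dw +]] _]; rewrite e0 => /esym/eqP.
    by rewrite absz_eq0 (negPf dw).
  - case: n => [|n] //=; rewrite /detl det_mx00 //.
case: vs => // v vs [sz]; have [v0|v0] := eqVneq v 0.
  (* A zero generator changes neither the zonotope nor the sum of determinants, and can only enlarge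
     the sum of minimal completions. *)
  have [c [c0 ck cm cn]] := IH _ vs sz; exists c; split=> //.
  - move=> k; rewrite -ck; congr (_%:R); apply/perm_size/uniq_perm; rewrite ?latpts_uniq// => z.
    apply/idP/idP => /(mem_latpts _ _ (ler0n _ _)) H; apply/(mem_latpts _ _ (ler0n _ _)).
      by move: H => /= [t _]; rewrite v0 intvec0 scaler0 subr0.
    by exists 0; rewrite ?lexx//= scale0r subr0.
  - move=> i; apply: (le_trans (cm i)) => /=; rewrite lerDl; case: i => // i.
    exact: subsum_ge0.
  - rewrite cn/=; case: n v vs v0 {sz c c0 ck cm cn} => [|n] v vs v0; rewrite ?addr0//.
    rewrite [X in _ + X](subsum_eq (W' := fun=> 0)) ?subsum0 ?addr0// => S _ _; rewrite v0.
    by rewrite -(scale0r (delta_mx 0 0)) detl_delta mul0r.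
case: n v vs sz v0 => [|n] v vs sz v0; first by case/eqP: v0; apply/rowP; case.
have [U [d [uU d0 vU]]] := smith_row v0.
have [c [c0 ck cm cn]] := IH _ [seq v *m U | v <- vs] (etrans (size_map _ _) sz).
have [c' [c'0 ck' cm' cn']] := IH _ [seq v *m proj0 n | v <- [seq v *m U | v <- vs]]
  (etrans (size_map _ _) (etrans (size_map _ _) sz)).
exists (fun i => c i + (if i is i'.+1 then d%:R * c' i' else 0)); split.
- by case=> [|i]; rewrite ?addr0// addr_ge0// mulr_ge0.
- move=> k; rewrite -(size_latpts_unimod _ (ler0n _ _) uU)/= vU size_latpts_cons.
  rewrite natrD natrM ck ck'; under [RHS]eq_bigr do rewrite mulrDl.
  rewrite big_split/=; congr (_ + _); rewrite [RHS]big_ord_recl/= mul0r add0r mulr_sumr.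
  apply: eq_bigr => i _; rewrite /bump/= add1n exprS natrM; ring.
- move=> i; pose G N (S : seq 'rV[int]_N) := (mincompl S)%:R : R.
  (* Each family is written as the image under [invmx U] of its transform, so that one inequality
     from [mincompl_unimod] per family suffices. *)
  have -> : subsum (v :: vs) i (fun S => (mincompl S)%:R) = subsum
     [seq u *m invmx U | u <- [seq u *m U | u <- v :: vs]] i (@G n.+1).
    by rewrite map_mulmxK// mulmxV.
  rewrite subsum_map; apply: (@le_trans _ _ (subsum [seq u *m U | u <- v :: vs] i (@G n.+1))).
    rewrite /= vU; apply: lerD; first exact: cm.
    case: i => // i; apply: (le_trans (ler_wpM2l _ (cm' i))) => //.
    rewrite subsum_map -subsumZ; apply: subsum_le => S sS _.
    by rewrite -natrM ler_nat mincompl_delta.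
  apply: subsum_le => S _ _; rewrite /G ler_nat.
  have := mincompl_unimod [seq u *m invmx U | u <- S] uU.
  by rewrite map_mulmxK// mulVmx.
- have -> : subsum (v :: vs) n.+1 (fun S => `|detl S|%:R) = subsum
     [seq u *m U | u <- v :: vs] n.+1 (fun S => `|detl S|%:R) :> R.
    rewrite subsum_map; apply: subsum_eq => S _ _.
    by rewrite detl_mul abszM unimod_absdet// muln1.
  rewrite /= vU cn; congr (_ + _); rewrite cn' subsum_map -subsumZ.
  by apply: subsum_eq => S _ _; rewrite detl_delta abszM natrM.
Qed.

End Ehrhart.

(** * Volume of unions of lattice cubes *)

Section Volume.
Variable R : realType.

(* Unlike in [ge0_le_integral], no measurability is needed: the integral of a nonnegative
   function is the supremum of the integrals of the simple functions below it. *)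
Lemma ge0_le_integralT (f g : R -> \bar R) :
  (forall x, 0 <= f x)%E -> (forall x, f x <= g x)%E ->
  (\int[@lebesgue_measure R]_x f x <= \int[@lebesgue_measure R]_x g x)%E.
Proof.
move=> f0 fg; have g0 x : (0 <= g x)%E by apply: le_trans (fg x).
rewrite !ge0_integralTE//; apply: le_ereal_sup => _ [h /= hf <-].
by exists h => //= x; exact: le_trans (fg x).
Qed.

Lemma ivol_ge0 n (A : set 'rV[R]_n) : (0 <= ivol A)%E.
Proof. by elim: n A => [|n IH] A /=; [case: ifP|apply: integral_ge0]. Qed.

Lemma ivol_mono n (A B : set 'rV[R]_n) : A `<=` B -> (ivol A <= ivol B)%E.
Proof.
elim: n A B => [|n IH] A B AB /=.
  case: ifP => [/asboolP/AB B0|_]; last by case: ifP.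
  by rewrite ifT//; apply/asboolP.
apply: ge0_le_integralT => x; first exact: ivol_ge0.
by apply: IH => y /AB.
Qed.

(** Being half-open, these cubes of side [1 / q] are pairwise disjoint, so their volumes simply add
    up. *)
Definition cubes n (s : seq 'rV[int]_n) (q : R) : set 'rV[R]_n :=
  [set x | exists2 z, z \in s & forall j, (z 0 j)%:~R <= q * x 0 j < (z 0 j)%:~R + 1].

Lemma ivol_cubes n (s : seq 'rV[int]_n) (q : R) :
  0 < q -> uniq s -> ivol (cubes s q) = ((size s)%:R / q ^+ n)%:E.
Proof.
move=> q0; elim: n s => [|n IH] s us /=.
  rewrite expr0 divr1; case: s us => [|z s] us /=.
    by rewrite asboolF// => -[z]; rewrite in_nil.
  have -> : s = [::].
    case: s us => // z' s /=; rewrite inE (_ : z = z') ?eqxx//.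
    by apply/rowP; case.
  by rewrite asboolT//; exists z => [|[]//]; rewrite mem_head.
have r0 (x : R) (y : 'rV[R]_n) : (row_mx (\row_(_ < 1) x) y : 'rV_n.+1) 0 0 = x.
  transitivity (row_mx (\row_(_ < 1) x) y 0 (lshift n 0)); last by rewrite row_mxEl mxE.
  by congr (row_mx _ _ _ _); exact: val_inj.
have rl (x : R) (y : 'rV[R]_n) j :
    (row_mx (\row_(_ < 1) x) y : 'rV_n.+1) 0 (lift 0 j) = y 0 j.
  rewrite -(row_mxEr (\row_(_ < 1) x) y 0 j).
  by congr (row_mx _ _ _ _); exact: val_inj.
pose I (z : 'rV[int]_n.+1) : set R := `[(z 0 0)%:~R / q, ((z 0 0)%:~R + 1) / q[%classic.
have IE z x : I z x <-> (z 0 0)%:~R <= q * x < (z 0 0)%:~R + 1.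
  by rewrite /I/= in_itv/= ler_pdivrMr// ltr_pdivlMr// mulrC.
have mI z : measurable (I z) by exact: measurable_itv.
transitivity (\int[@lebesgue_measure R]_x \sum_(z <- s) ((q ^+ n)^-1%:E * (\1_(I z) x)%:E))%E.
  apply: eq_integral => x _.
  (* The section at [x] meets only the cubes whose first coordinate is the floor of [q * x]; on
     these the projection is injective. *)
  pose sx := [seq z *m proj0 n | z : 'rV[int]_n.+1 <- s & z 0 0 == Num.floor (q * x)].
  have fl (z : 'rV[int]_n.+1) : (z 0 0 == Num.floor (q * x)) =
      ((z 0 0)%:~R <= q * x < (z 0 0)%:~R + 1).
    by rewrite eq_sym floor_eq rmorphD.
  have -> : [set y : 'rV_n | cubes s q (row_mx (\row_(_ < 1) x) y)] = cubes sx q.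
    apply/seteqP; split => y /= [z zs H].
      exists (z *m proj0 n).
        apply: map_f; rewrite mem_filter zs andbT fl.
        by have := H 0; rewrite r0.
      by move=> j; have := H (lift 0 j); rewrite mul_proj0 rl.
    move/mapP: zs => [z' + ez]; rewrite mem_filter fl => /andP[z0 z's]; exists z' => // j.
    have [j1 ->|->] := unliftP 0 j.
      by have := H j1; rewrite ez mul_proj0 rl.
    by rewrite r0.
  rewrite IH; last first.
    rewrite map_inj_in_uniq ?filter_uniq// => z z'.
    rewrite !mem_filter => /andP[/eqP z0 _] /andP[/eqP z'0 _] e.
    by rewrite (proj0_split z) (proj0_split z') z0 z'0 e.
  rewrite size_map size_filter -sum1_count natr_sum mulr_suml.
  rewrite big_mkcond/= -sumEFin; apply: eq_bigr => z _; rewrite indicE fl.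
  case: ifPn => H; first by rewrite mem_set ?mule1 ?mul1r//; apply/IE.
  by rewrite memNset ?mule0// => /IE; apply/negP.
have qn : 0 <= (q ^+ n)^-1 by rewrite invr_ge0 exprn_ge0// ltW.
rewrite ge0_integral_sum//; last first.
- by move=> z x _; rewrite mule_ge0 ?lee_fin.
- by move=> z; apply: measurable_funeM; apply/measurable_EFinP; apply: measurable_indic; exact: mI.
rewrite (eq_bigr (fun=> ((q ^+ n.+1)^-1)%:E)); last first.
  move=> z _; rewrite ge0_integralZl_EFin//; last first.
    by apply/measurable_EFinP; apply: measurable_indic; exact: mI.
  rewrite integral_indic; [|exact: measurableT|exact: mI].
  rewrite classical_sets.setIT.
  have mIE : @lebesgue_measure R (I z) = (q^-1)%:E.
    rewrite /I lebesgue_measure_itv/= lte_fin ltr_pM2r ?invr_gt0// ltrDl ltr01.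
    by rewrite -EFinD; congr (_%:E); field; rewrite gt_eqF.
  transitivity ((q ^+ n)^-1%:E * (q^-1)%:E)%E; first by congr (_ * _)%E; exact: mIE.
  by rewrite -EFinM exprSr invfM.
rewrite sumEFin; congr (_%:E); rewrite big_const_seq count_predT iter_addr_0.
by rewrite mulr_natl.
Qed.

End Volume.

(** * The counting argument for Minkowski's second theorem *)

Lemma leq_size_inj (S T : eqType) (f : S -> T) (X : seq S) (Y : seq T) :
  uniq X -> (forall x, x \in X -> f x \in Y) -> {in X &, injective f} ->
  (size X <= size Y)%N.
Proof.
move=> uX fY fI; rewrite -(size_map f); apply: uniq_leq_size.
  by rewrite map_inj_in_uniq.
by move=> _ /mapP[x xX ->]; exact: fY.
Qed.

(** Since [g] determines [f] on [X], the values of [f] are images of the values of [g]. *)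
Lemma leq_size_undup_map (S T T' : eqType) (f : S -> T) (g : S -> T') (X : seq S) :
  {in X &, forall x y, g x = g y -> f x = f y} ->
  (size (undup (map f X)) <= size (undup (map g X)))%N.
Proof.
case: X => [//|x0 X0]; set X := x0 :: X0 => gf.
pose h t := f (nth x0 X (find (fun x => g x == t) X)).
have hg x : x \in X -> h (g x) = f x.
  move=> xX; have hs : has (fun x' => g x' == g x) X by apply/hasP; exists x.
  by apply: gf => //; [rewrite mem_nth// -has_find|exact/eqP/(nth_find x0 hs)].
have sub : {subset undup (map f X) <= map h (undup (map g X))}.
  move=> t; rewrite mem_undup => /mapP[x xX ->]; apply/mapP; exists (g x); last by rewrite hg.
  by rewrite mem_undup map_f.
by rewrite -(size_map h); apply: uniq_leq_size sub; exact: undup_uniq.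
Qed.

Section Minkowski.
Variables (R : realType) (n : nat) (vs : seq 'rV[int]_n).
Local Notation latpts := (@latpts R n vs).

(** This is membership of [z] in [l DZ]: the translation part of [Z] cancels in the difference. *)
Definition lattice_diff (l : R) (z : 'rV[int]_n) : Prop :=
  exists a b, [/\ zon vs l a, zon vs l b & intvec R z = a - b].

Definition reduce_tail (d q : nat) (z : 'rV[int]_n) : 'rV[int]_n :=
  \row_j (if (j < d)%N then z 0 j else modz (z 0 j) q).

(** This counts the image of the lattice points of [aZ] in [Z^d x (Z/q)^(n-d)]. It interpolates
    between all points, at [d = n], and at most [q ^ n] residues, at [d = 0]. *)
Definition residue_count (d q : nat) (a : R) : nat := size (undup (map (reduce_tail d q) (latpts a))).

Lemma reduce_tailD d q x e : reduce_tail d q (reduce_tail d q x + e) = reduce_tail d q (x + e).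
Proof. by apply/rowP => j; rewrite !mxE; case: (j < d)%N; rewrite ?modzDml. Qed.

Lemma reduce_tail_id d q x : reduce_tail d q (reduce_tail d q x) = reduce_tail d q x.
Proof. by have := reduce_tailD d q x 0; rewrite !addr0. Qed.

(** Full-dimensionality enters in this form: a bounded error is absorbed by a bounded dilate, after
    an integral translation. *)
Hypothesis hbox : forall B : nat, exists (h : R) (y : 'rV[int]_n), 0 <= h /\
  forall x : 'rV[R]_n, (forall j, `|x 0 j| <= B%:R) -> zon vs h (x + intvec R y).

(* Dilating by [A' / A] in the exact coordinates sends the fibre over [A w + r] to the
   fibres over [A' w + r + r'], which contain integral translates of it, up to the fixed
   error [h]. *)
Lemma residue_count_dilate (d A0 A' : nat) : (d <= n)%N -> (A0 < A')%N ->
  exists2 h : R, 0 <= h & forall (q : nat) (a : R), 0 <= a ->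
   (A' ^ d * residue_count d q a <= A0.+1 ^ d * residue_count d q (A'%:R / A0.+1%:R * a + h))%N.
Proof.
set A := A0.+1 => dn AA'; have [h [y [h0 hy]]] := hbox (A' + A'); exists h => // q a a0.
set a' := _ * a + h; pose L := latpts a; pose wd := widen_ord dn.
have AR : 0 < A%:R :> R by rewrite ltr0n.
have AZ : A%:Z != 0 by [].
have a'0 : 0 <= a' by rewrite addr_ge0// !mulr_ge0// invr_ge0.
pose tl (c z : 'rV[int]_n) := [forall k : 'I_d, c 0 (wd k) == z 0 (wd k)].
(* The representative depends only on the first [d] coordinates of [c], so the translation [e]
   defined from it can be recovered from those coordinates. *)
pose rep c := nth 0 L (find (tl c) L).
have repP c : c \in undup (map (reduce_tail d q) L) -> rep c \in L /\ forall k, rep c 0 (wd k) = c 0 (wd k).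
  rewrite mem_undup => /mapP[x xL cx].
  have hs : has (tl c) L.
    by apply/hasP; exists x => //; apply/forallP => k; rewrite cx mxE /= ltn_ord.
  split; first by rewrite mem_nth// -has_find.
  by move=> k; have /forallP/(_ k)/eqP -> := nth_find 0 hs.
pose w c : 'rV[int]_n := map_mx (fun z => (z %/ A)%Z) (rep c).
pose s (r : {ffun 'I_d -> 'I_A'}) : 'rV[int]_n :=
  \row_j oapp (fun k : 'I_d => (val (r k))%:Z) 0 (insub (val j)).
have sE r k : s r 0 (wd k) = (val (r k))%:Z by rewrite mxE /= valK.
have s01 r j : 0 <= s r 0 j <= A'%:Z.
  by rewrite mxE; case: insub => //= k; have := ltn_ord (r k); lia.
pose e r c := (A'%:Z - A%:Z) *: w c + s r + y.
(* Recording the residues modulo [A] of the exact coordinates makes the map injective and accounts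
   for the factor [A ^ d]. *)
pose f (rc : {ffun 'I_d -> 'I_A'} * 'rV[int]_n) : {ffun 'I_d -> 'I_A} * 'rV[int]_n :=
  ([ffun k => inord `|modz (rc.2 ord0 (wd k)) A|%N], reduce_tail d q (rc.2 + e rc.1 rc.2)).
have -> : (A' ^ d = size (enum {: {ffun 'I_d -> 'I_A'}}))%N.
  by rewrite -cardE card_ffun !card_ord.
have -> : (A ^ d = size (enum {: {ffun 'I_d -> 'I_A}}))%N.
  by rewrite -cardE card_ffun !card_ord.
rewrite -!(size_allpairs pair); apply: (@leq_size_inj _ _ f).
- by rewrite allpairs_uniq ?enum_uniq ?undup_uniq// => -[? ?] [].
- move=> _ /allpairsP[[r c] /= [_ cP ->]]; apply/allpairsP; exists (f (r, c)); split => //.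
    by rewrite mem_enum.
  have [rL rk] := repP c cP; have /mapP[x xL cx] : c \in map (reduce_tail d q) L by rewrite -mem_undup.
  rewrite mem_undup /= {1}cx reduce_tailD; apply: map_f; apply/(mem_latpts _ _ a'0).
  move/(mem_latpts _ _ a0) : xL => zx; move/(mem_latpts _ _ a0) : rL => zr.
  have -> : a' = (a + ((A'%:R - A%:R) / A%:R) * a) + h.
    by rewrite /a' mulrBl divff ?gt_eqF//; ring.
  (* The entries of [b] are at most [(A' - A) + A'] in absolute value, which the box of size
     [A' + A'] covers. *)
  pose b := (A'%:R - A%:R) *: (intvec R (w c) - A%:R^-1 *: intvec R (rep c)) + intvec R (s r).
  have -> : intvec R (x + e r c) =
     (intvec R x + ((A'%:R - A%:R) / A%:R) *: intvec R (rep c)) + (b + intvec R y).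
    rewrite /e /b !intvecD intvecZ rmorphB/= -!pmulrn; apply/rowP => j; rewrite !mxE; ring.
  apply: zonD; first apply: zonD => //.
    by apply: zonZ => //; rewrite divr_ge0// subr_ge0 ler_nat.
  apply: hy => j; rewrite /b !mxE.
  have := divz_eq (rep c 0 j) A; have := modz_ge0 (rep c 0 j) AZ.
  have := ltz_mod (rep c 0 j) AZ; set m := (_ %% _)%Z; set u := (_ %/ _)%Z => mA m0 E.
  have -> : u%:~R - A%:R^-1 * (rep c 0 j)%:~R = - (m%:~R / A%:R) :> R.
    by rewrite E rmorphD rmorphM/= -pmulrn; field; rewrite gt_eqF.
  have mR0 : 0 <= m%:~R / A%:R :> R by rewrite divr_ge0 ?ler0z.
  have mR1 : m%:~R / A%:R <= 1 :> R.
    by rewrite ler_pdivrMr// mul1r [leRHS]pmulrn ler_int ltW.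
  have /andP[S0 S1] := s01 r j; rewrite mxE in S0 S1.
  set S := oapp _ _ _ in S0 S1 *.
  have SR0 : 0 <= S%:~R :> R by rewrite ler0z.
  have SR1 : S%:~R <= A'%:R :> R by rewrite [leRHS]pmulrn ler_int.
  have AA : A%:R <= A'%:R :> R by rewrite ler_nat.
  rewrite natrD (le_trans (ler_normD _ _))// lerD//; last by rewrite ger0_norm.
  rewrite mulrN normrN normrM !ger0_norm ?subr_ge0//.
  rewrite (le_trans (ler_wpM2l _ mR1)) ?subr_ge0// mulr1 gerBl; exact: ltW.
have allP r c : (r, c) \in [seq (x, y) | x <- enum {: {ffun 'I_d -> 'I_A'}}, y <- undup (map (reduce_tail d q) L)] ->
    c \in undup (map (reduce_tail d q) L).
  by move=> /allpairsP[[? ?] /= [_ ? [_ ->]]].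
move=> [r1 c1] [r2 c2] /allP c1P /allP c2P [] /ffunP er ec.
have reduce_tail_wd z k : reduce_tail d q z 0 (wd k) = z 0 (wd k) by rewrite mxE /= ltn_ord.
have eE r c k : (c + e r c) 0 (wd k) =
    c 0 (wd k) + ((A'%:Z - A%:Z) * w c 0 (wd k) + (val (r k))%:Z + y 0 (wd k)).
  by rewrite mxE [X in _ + X]mxE [X in _ + (X + _)]mxE [X in _ + (X + _ + _)]mxE sE.
(* With equal residues modulo [A], the images determine [A' * w + r]. As [0 <= r < A'], division
   with remainder recovers [w] and [r]. *)
have key k : w c1 0 (wd k) = w c2 0 (wd k) /\ r1 k = r2 k /\ c1 0 (wd k) = c2 0 (wd k).
  have W1 : w c1 0 (wd k) = divz (c1 0 (wd k)) A by rewrite mxE (repP c1 c1P).2.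
  have W2 : w c2 0 (wd k) = divz (c2 0 (wd k)) A by rewrite mxE (repP c2 c2P).2.
  move: ec => /(congr1 (fun z : 'rV_n => z 0 (wd k))); rewrite !reduce_tail_wd !eE => ec.
  have := congr1 val (er k); rewrite !ffunE/= !inordK; last 2 first.
  - by have := ltz_mod (c2 0 (wd k)) AZ; have := modz_ge0 (c2 0 (wd k)) AZ; move: (_ %% _)%Z => ?; lia.
  - by have := ltz_mod (c1 0 (wd k)) AZ; have := modz_ge0 (c1 0 (wd k)) AZ; move: (_ %% _)%Z => ?; lia.
  have m1 := modz_ge0 (c1 0 (wd k)) AZ; have m2 := modz_ge0 (c2 0 (wd k)) AZ.
  have d1 := divz_eq (c1 0 (wd k)) A; have d2 := divz_eq (c2 0 (wd k)) A.
  move=> /(congr1 Posz); rewrite !gez0_abs// => em.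
  rewrite -em in d2; have R1 : (val (r1 k) < A')%N := ltn_ord (r1 k).
  have R2 : (val (r2 k) < A')%N := ltn_ord (r2 k).
  rewrite W1 W2 in ec *.
  clear em m1 m2 er W1 W2.
  move: (modz (c1 0 (wd k)) A) d1 d2 => m; move: (divz (c1 0 (wd k)) A) ec => u1.
  move: (divz (c2 0 (wd k)) A) => u2; move: (c1 0 (wd k)) (c2 0 (wd k)) (y 0 (wd k)) => b1 b2 b3.
  move=> ec d1 d2.
  have E : u1 * A'%:Z + (val (r1 k))%:Z = u2 * A'%:Z + (val (r2 k))%:Z.
    move: ec; rewrite d1 d2; move: (val (r1 k))%:Z (val (r2 k))%:Z => a1 a2 ec.
    transitivity (u1 * A + m + ((A'%:Z - A%:Z) * u1 + a1 + b3) - (m + b3)); first by ring.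
    by rewrite ec; ring.
  have u12 : u1 = u2.
    move: (val (r1 k)) (val (r2 k)) R1 R2 E => a1 a2 R1 R2 E; clear -R1 R2 E.
    have [u12|u21|//] := ltgtP u1 u2.
      have : 0 <= (u2 - u1 - 1) * A'%:Z by apply: mulr_ge0; lia.
      by rewrite !mulrBl; lia.
    have : 0 <= (u1 - u2 - 1) * A'%:Z by apply: mulr_ge0; lia.
    by rewrite !mulrBl; lia.
  rewrite u12 in E d1 *; split=> //; split; last by rewrite d1 d2.
  by apply: val_inj; move: E => /addrI[].
have ew : w c1 = w c2.
  rewrite /w (_ : rep c1 = rep c2)// /rep; congr (nth _ _ _); apply: eq_find => z.
  by rewrite /tl; apply: eq_forallb => k; rewrite (key k).2.2.
have er' : r1 = r2 by apply/ffunP => k; exact: (key k).2.1.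
congr (_, _) => //.
have rc c : c \in undup (map (reduce_tail d q) L) -> reduce_tail d q c = c.
  by rewrite mem_undup => /mapP[x _ ->]; rewrite reduce_tail_id.
rewrite -(rc _ c1P) -(rc _ c2P) -(addrK (e r1 c1) c1) -(addrK (e r2 c2) c2).
by rewrite -reduce_tailD ec reduce_tailD /e ew er'.
Qed.

(** If two points agree exactly in the first [d] coordinates and modulo [q] in the others, their
    difference is [q z] with [z] in [(a / q) DZ]. As [a / q < Lam], coordinate [d] of [z] vanishes,
    so the points also agree exactly there. *)
Lemma residue_count_glue (d q : nat) (a Lam : R) : (0 < q)%N -> 0 < a -> a < q%:R * Lam ->
  (forall l z, 0 < l < Lam -> lattice_diff l z -> forall j : 'I_n, (j <= d)%N -> z 0 j = 0) ->
  (residue_count d.+1 q a <= residue_count d q a)%N.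
Proof.
move=> q0 a0 aq H; have q0R : 0 < q%:R :> R by rewrite ltr0n.
apply: leq_size_undup_map => x y /(mem_latpts _ _ (ltW a0)) xL /(mem_latpts _ _ (ltW a0)) yL exy.
have dvd j : x 0 j - y 0 j \in dvdz q.
  have := congr1 (fun z : 'rV_n => z 0 j) exy; rewrite !mxE.
  case: ifP => _ e; first by rewrite e subrr dvdz0.
  by rewrite -eqz_mod_dvd; apply/eqP.
pose z : 'rV[int]_n := \row_j divz (x 0 j - y 0 j) q.
have zE j : z 0 j * q = x 0 j - y 0 j by rewrite mxE divzK.
have dz : lattice_diff (a / q%:R) z.
  exists (q%:R^-1 *: intvec R x), (q%:R^-1 *: intvec R y); split.
  - by rewrite mulrC; apply: zonZ xL; rewrite invr_ge0.
  - by rewrite mulrC; apply: zonZ yL; rewrite invr_ge0.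
  rewrite -scalerBr -intvecB; apply/rowP => j.
  rewrite [LHS]mxE [RHS]mxE [X in _ * X]mxE.
  have -> : (x - y) 0 j = z 0 j * q by rewrite zE !mxE.
  by rewrite rmorphM/= -pmulrn mulrC mulfK ?gt_eqF.
have aql : 0 < a / q%:R < Lam by rewrite divr_gt0//= ltr_pdivrMr// mulrC.
apply/rowP => j; have := congr1 (fun z : 'rV_n => z 0 j) exy; rewrite !mxE ltnS.
have [jd|jd|jd] := ltngtP j d => //= _.
by apply/eqP; rewrite -subr_eq0 -zE (H _ _ aql dz) ?mul0r// jd.
Qed.

Lemma residue_count_full q a : residue_count n q a = size (latpts a).
Proof.
rewrite /residue_count (_ : map _ _ = latpts a) ?undup_id ?latpts_uniq//.
rewrite -[RHS]map_id; apply: eq_map => z; apply/rowP => j.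
by rewrite mxE ltn_ord.
Qed.

Lemma residue_count0_le q a : (0 < q)%N -> (residue_count 0 q a <= q ^ n)%N.
Proof.
case: q => // q _; pose X : seq 'rV[int]_n :=
  [seq \row_j (val (f j))%:Z | f : {ffun 'I_n -> 'I_q.+1}].
have <- : size X = (q.+1 ^ n)%N by rewrite size_map -cardE card_ffun !card_ord.
apply: uniq_leq_size; first exact: undup_uniq.
move=> z; rewrite mem_undup => /mapP[x _ ->]; apply/mapP.
exists [ffun j => inord `|modz (x ord0 j) q.+1|%N]; first by rewrite mem_enum.
have qZ : q.+1%:Z != 0 by [].
apply/rowP => j; rewrite !mxE ffunE/= inordK ?gez0_abs ?modz_ge0//.
by have := ltz_mod (x ord0 j) qZ; have := modz_ge0 (x ord0 j) qZ; move: (_ %% _)%Z => ?; lia.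
Qed.

(** Gluing, which makes one more coordinate matter only modulo [q], alternates with dilation by
    [A i.+1 / A i]. The powers of these ratios telescope to the product of the [A k]. *)
Lemma residue_count_chain (A : nat -> nat) (L : nat -> R) :
  (forall i, 0 < A i)%N -> (forall i, A i <= A i.+1)%N ->
  (forall i l z, (i < n)%N -> 0 < l < L i -> lattice_diff l z ->
     forall j : 'I_n, (j < n - i)%N -> z 0 j = 0) ->
  forall i, (i <= n)%N -> exists2 C : R, 0 <= C & forall (t : R) (q : nat),
    0 < t -> (0 < q)%N ->
    (forall k, (k < i)%N -> (A k)%:R * t + C < q%:R * L k) ->
    (size (latpts ((A 0)%:R * t)) * \prod_(k < i) A k * A i ^ (n - i) <=
     A 0 ^ n * residue_count (n - i) q ((A i)%:R * t + C))%N.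
Proof.
move=> A0 AS flag; elim=> [|i IH] lin.
  exists 0 => // t q t0 q0 _; rewrite big_ord0 muln1 subn0 addr0 residue_count_full.
  by rewrite mulnC.
have [C C0 HC] := IH (ltnW lin).
have [h h0 Hh] : exists2 h : R, 0 <= h & forall q (a : R), 0 <= a ->
   (A i.+1 ^ (n - i.+1) * residue_count (n - i.+1) q a <=
    A i ^ (n - i.+1) * residue_count (n - i.+1) q ((A i.+1)%:R / (A i)%:R * a + h))%N.
  have := @residue_count_dilate (n - i.+1) (A i).-1 (A i.+1) (leq_subr _ _).
  by rewrite prednK; [apply; exact: AS|exact: A0].
have AiR k : 0 < (A k)%:R :> R by rewrite ltr0n.
(* Dilating [A i * t + C] by [A i.+1 / A i] and adding [h] gives [A i.+1 * t] plus this constant. *)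
exists ((A i.+1)%:R / (A i)%:R * C + h).
  by rewrite addr_ge0// !mulr_ge0// invr_ge0.
move=> t q t0 q0 cond.
have leC : C <= (A i.+1)%:R / (A i)%:R * C + h.
  by rewrite ler_wpDr// ler_peMl// ler_pdivlMr// mul1r ler_nat.
have cond' k : (k < i.+1)%N -> (A k)%:R * t + C < q%:R * L k.
  by move=> /cond; apply: le_lt_trans; rewrite lerD2l.
have a0 : 0 < (A i)%:R * t + C by rewrite ltr_wpDr// mulr_gt0.
have {HC} := HC t q t0 q0 (fun k ki => cond' k (ltnW ki)).
have -> : (n - i = (n - i.+1).+1)%N by lia.
move=> H1.
have H2 : (residue_count (n - i.+1).+1 q ((A i)%:R * t + C) <= residue_count (n - i.+1) q ((A i)%:R * t + C))%N.
  apply: (residue_count_glue q0 a0 (cond' i (ltnSn i))) => l z ll dz j jd.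
  by apply: (flag i l z lin ll dz); lia.
have H3 := Hh q _ (ltW a0).
rewrite mulrDr mulrA divfK ?gt_eqF// -addrA in H3.
have p0 : (0 < A i ^ (n - i.+1))%N by rewrite expn_gt0 A0.
rewrite -(leq_pmul2r p0) big_ord_recr/=.
set pa := residue_count _ _ _ in H1; rewrite -/pa in H2.
set pb := residue_count _ _ _ in H2; rewrite -/pb in H3.
set pc := residue_count _ _ _ in H3 *.
set N := size _ in H1 *; set P := \prod_(k < i) _ in H1 *.
set x := A i in H1 H3 p0 *; set m := (n - i.+1)%N in H1 H2 H3 p0 *.
set y := A i.+1 in H3 *; set X := (A 0 ^ n)%N in H1 *.

apply: (@leq_trans (N * P * x ^ m.+1 * y ^ m)).
  by rewrite expnS; apply: eq_leq; ring.
apply: (@leq_trans (X * pa * y ^ m)); first by rewrite leq_mul2r H1 orbT.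
apply: (@leq_trans (X * (y ^ m * pb))).
  by rewrite -mulnA leq_mul2l mulnC leq_mul2l H2 !orbT.
by rewrite -mulnA leq_mul2l (mulnC pc) H3 orbT.
Qed.

End Minkowski.

(** * Independent families, completions and flag bases *)

(** By Bernoulli's inequality, [e = (a - b) / ((n + 1) a)] would contradict the hypothesis if
    [b < a]. *)
Lemma exp_limit (R : realType) (n : nat) (a b : R) : 0 <= b ->
  (forall e, 0 < e < 1 -> (1 - e) ^+ n * a <= b) -> a <= b.
Proof.
move=> b0 H; rewrite leNgt; apply/negP => ba; have a0 : 0 < a := le_lt_trans b0 ba.
pose e := (a - b) / (n.+1%:R * a).
have n0 : 0 < n.+1%:R * a by rewrite mulr_gt0.
have e0 : 0 < e by rewrite divr_gt0 ?subr_gt0.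
have ena : e * (n.+1%:R * a) = a - b by rewrite divfK ?gt_eqF.
have nR : n.+1%:R = n%:R + 1 :> R by rewrite natr1.
have nR0 : 0 <= n%:R :> R by [].
have e0' := ltW e0.
have e1 : e <= 1.
  rewrite ler_pdivrMr// mul1r nR mulrDl mul1r.
  by rewrite (le_trans (y := a)) ?gerBl// lerDr mulr_ge0// ltW.
have B m : 1 - m%:R * e <= (1 - e) ^+ m.
  elim: m => [|m IH]; first by rewrite mul0r subr0.
  rewrite exprS; apply: le_trans (ler_wpM2l _ IH); last by rewrite subr_ge0.
  rewrite -natr1; have : 0 <= m%:R * e * e by apply: mulr_ge0 => //; apply: mulr_ge0.
  lra.
(* The choice [e = 1] is excluded from the hypothesis; it forces [b = 0], and [1 / 2] then gives the
   contradiction. *)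
have [e11|e11] := eqVneq e 1.
  move: ena; rewrite e11 mul1r nR mulrDl mul1r => ena.
  have : 0 <= n%:R * a by rewrite mulr_ge0// ltW.
  have bb : b = 0 by have : 0 <= n%:R * a by [rewrite mulr_ge0// ltW]; lra.
  have := H (2^-1) _; have h2 : 0 < (2^-1 : R) < 1 by lra.
  by move=> /(_ h2); rewrite bb leNgt mulr_gt0// exprn_gt0//; lra.
have := H e; rewrite e0/= lt_neqAle e11 e1 => /(_ isT).
have := ler_wpM2r (ltW a0) (B n).
have : e * (n.+1%:R * a) = n%:R * e * a + e * a by rewrite nR; ring.
have : 0 < e * a by rewrite mulr_gt0.
rewrite ena mulrBl mul1r; lra.
Qed.

Section Independence.
Variable R : realType.

Lemma row_free_col_mx r n (A : 'M[R]_(r, n)) (v : 'rV[R]_n) :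
  row_free A -> ~~ (v <= A)%MS -> row_free (col_mx A v).
Proof.
move=> fA vA; rewrite /row_free eqn_leq rank_leq_row/= -addsmxE.
have : (A < A + v)%MS.
  by rewrite ltmxE addsmxSl; apply: contra vA; apply: submx_trans; exact: addsmxSr.
by move/rank_ltmx; rewrite addn1 (eqP fA).
Qed.

Lemma row_free_usub r s n (A : 'M[R]_(r, n)) (B : 'M[R]_(s, n)) :
  row_free (col_mx A B) -> row_free A.
Proof.
rewrite /row_free -addsmxE => /eqP e; rewrite eqn_leq rank_leq_row/=.
have := (mxrank_adds_leqif A B).1; rewrite e => /leq_trans/(_ (leq_add (leqnn _) (rank_leq_row B))).
by rewrite leq_add2r.
Qed.

Definition mxl n r (T : seq 'rV[int]_n) : 'M[R]_(r, n) :=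
  \matrix_(i, j) (nth 0 T i 0 j)%:~R.

Lemma det_mxl n (T : seq 'rV[int]_n) : \det (mxl n T) = (detl T)%:~R.
Proof. by rewrite -det_map_mx; congr (\det _); apply/matrixP => i j; rewrite !mxE. Qed.

Lemma mxl_cat n r s (T T' : seq 'rV[int]_n) : size T = r ->
  mxl (r + s) (T ++ T') = col_mx (mxl r T) (mxl s T').
Proof.
move=> sT; apply/matrixP => i j; rewrite !mxE.
case: splitP => k ik; rewrite !mxE nth_cat sT ik; first by rewrite ltn_ord.
by rewrite ltnNge leq_addr/= addKn.
Qed.

Lemma row_free_completes n r s (S w : seq 'rV[int]_n) :
  size S = r -> (r + s)%N = n -> detl (S ++ w) != 0 -> row_free (mxl r S).
Proof.
move=> sS e; subst n => d; apply: (@row_free_usub _ s _ _ (mxl s w)).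
by rewrite -mxl_cat// row_free_unit unitmxE det_mxl unitfE intr_eq0.
Qed.

(** No subspace of dimension below [k] contains [E]; that is, [E] spans dimension at least [k]. *)
Definition escapes n (E : 'rV[int]_n -> Prop) (k : nat) : Prop :=
  forall r (A : 'M[R]_(r, n)), (r < k)%N -> exists2 z, E z & ~~ (intvec R z <= A)%MS.

(** The choice is greedy: when [r + j] vectors are present, [E j] still contains a vector outside
    their span. *)
Lemma exists_completion n (E : nat -> 'rV[int]_n -> Prop) m r (S : seq 'rV[int]_n) :
  size S = r -> (r + m)%N = n -> row_free (mxl r S) ->
  (forall j, (j < m)%N -> escapes (E j) (r + j).+1) ->
  exists us, [/\ size us = m, forall j, (j < m)%N -> E j (nth 0 us j) & detl (S ++ us) != 0].
Proof.
elim: m r S E => [|m IH] r S E sS rn fS Ej.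
  exists [::]; split=> //; rewrite cats0; rewrite addn0 in rn; subst n.
  by move: fS; rewrite row_free_unit unitmxE det_mxl unitfE intr_eq0.
have r0 : (r < (r + 0).+1)%N by rewrite addn0.
have [u Eu uS] := Ej 0%N isT r (mxl r S) r0.
have sS' : size (rcons S u) = (r + 1)%N by rewrite size_rcons sS addn1.
have fS' : row_free (mxl (r + 1) (rcons S u)).
  rewrite -cats1 mxl_cat//; apply: row_free_col_mx => //.
  by rewrite (_ : mxl 1 _ = intvec R u)//; apply/rowP => j; rewrite !mxE.
have [||us [sus Eus d]] := IH (r + 1)%N (rcons S u) (fun j => E j.+1) sS' _ fS'.
- by rewrite -rn addn1 addSnnS.
- by move=> j jm; rewrite -addnA; apply: Ej.
exists (u :: us); split; rewrite ?cat_rcons in d *; rewrite /= ?sus//.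
by case=> // j jm; exact: Eus.
Qed.

(** The vectors [us] are replaced by generators one at a time: the determinant is linear in each
    row, and [zon_abs] bounds the cost of replacing row [j] by the factor [l j]. *)
Lemma detl_bound n (vs : seq 'rV[int]_n) m (S us : seq 'rV[int]_n) (l : nat -> R) :
  (size S + m)%N = n -> size us = m -> (forall j, 0 <= l j) ->
  (forall j, (j < m)%N -> lattice_diff vs (l j) (nth 0 us j)) ->
  `|detl (S ++ us)|%:R <=
   \prod_(j < m) l j * tupsum vs m (fun h => `|detl (S ++ h)|%:R).
Proof.
elim: m S us l => [|m IH] S us l sn.
  by move=> /size0nil -> _ _; rewrite big_ord0 mul1r.
case: us => // u us [sus] l0 dus; rewrite big_ord_recl /=.
have sS : (size S < n)%N by move: (leq_addr m (size S).+1); rewrite addSnnS sn.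
have [C HC] := detl_linear us sS.
have Habs v : `|detl (S ++ v :: us)|%:R = `|(intvec R v *m map_mx intr C) 0 0|.
  by rewrite HC -intvec_mul [in RHS]mxE natr_absz intr_norm.
have [a [b [za zb ab]]] := dus 0%N isT.
rewrite Habs [intvec R u]ab (le_trans (zon_abs _ za zb))// -mulrA ler_wpM2l//.
rewrite mulr_sumr; apply: ler_sum => v _; rewrite -Habs -cat_rcons.
apply: (le_trans (IH _ _ (fun j => l j.+1) _ sus _ _)) => //.
- by rewrite size_rcons addSnnS.
- by move=> j jm; apply: (dus j.+1).
by rewrite ler_wpM2l ?prodr_ge0// tupsum_le// => h _; rewrite cat_rcons.
Qed.

(** Both sides equal the sum over all [n]-tuples, split on the left after the first [i] entries. *)
Lemma subsum_tupsum_full n (vs : seq 'rV[int]_n) i : (i <= n)%N ->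
  i`!%:R * subsum vs i (fun S => tupsum vs (n - i) (fun h => `|detl (S ++ h)|%:R : R)) =
  n`!%:R * subsum vs n (fun S => `|detl S|%:R).
Proof.
move=> lin; rewrite -tupsum_subsum; last first.
  split=> [S S' sS p|S sS u].
    apply: tupsum_eq => h sh; rewrite (@detl_perm _ _ (S' ++ h)) ?perm_cat2r//.
    by rewrite size_cat sS sh subnKC.
  apply: tupsum0 => h sh; rewrite detl_alt ?size_cat ?sS ?sh ?subnKC//.
  by rewrite cat_uniq (negPf u).
have := @tupsum_cat R _ vs i (n - i) (fun S => `|detl S|%:R); rewrite subnKC// => <-.
by rewrite tupsum_subsum//; exact: detl_sym_alt.
Qed.

(** Each independent [S] is completed by vectors of [l k DZ], [i < k <= n], which bounds
    [mincompl S] through [detl_bound]; [subsum_tupsum_full] then counts the bases. *)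
Lemma subsum_mincompl_le n (vs : seq 'rV[int]_n) i (l : nat -> R) :
  (i <= n)%N -> (forall j, 0 <= l j) ->
  (forall k, (i < k <= n)%N -> escapes (lattice_diff vs (l k)) k) ->
  subsum vs i (fun S => (mincompl S)%:R) <=
  n`!%:R / i`!%:R * \prod_(i.+1 <= k < n.+1) l k * subsum vs n (fun S => `|detl S|%:R).
Proof.
move=> lin l0 esc; have i0 : i`!%:R != 0 :> R by rewrite pnatr_eq0 -lt0n fact_gt0.
have -> : n`!%:R / i`!%:R * \prod_(i.+1 <= k < n.+1) l k * subsum vs n (fun S => `|detl S|%:R) =
   (i`!%:R)^-1 * \prod_(i.+1 <= k < n.+1) l k *
   (n`!%:R * subsum vs n (fun S => `|detl S|%:R)) by ring.
rewrite -(subsum_tupsum_full vs lin) mulrAC !mulrA mulVf// mul1r mulrC -subsumZ.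
apply: subsum_le => S sS _; case E : (mincompl S == 0%N).
  by rewrite (eqP E) mulr_ge0 ?tupsum_ge0// prodr_ge0.
have [w [sw dw _]] := mincompl_neq0 E.
have [||||us [sus dus d]] := @exists_completion n (fun j => lattice_diff vs (l (i + j).+1)) (n - i) i S.
- exact: sS.
- by rewrite subnKC.
- by apply: (row_free_completes sS (subnKC lin) dw).
- by move=> j jm; apply: esc; rewrite ltnS leq_addr/=; lia.
have c : completes S `|detl (S ++ us)|%N.
  by exists us; split=> //; rewrite size_cat sS sus subnKC.
apply: (@le_trans _ _ `|detl (S ++ us)|%:R); first by rewrite ler_nat; apply: (mincomplP c).2.
have := @detl_bound n vs (n - i) S us (fun j => l (i + j).+1).
rewrite sS subnKC// => /(_ erefl sus (fun j => l0 _) dus).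
by rewrite -[i.+1]add0n big_addn subSS big_mkord; under [in X in _ -> X]eq_bigr do rewrite addnS addnC.
Qed.

End Independence.

(** * Lattice bases adapted to an increasing chain of sets of lattice vectors *)

Section Flag.
Variable R : realType.

Definition indep_in n (E : 'rV[int]_n -> Prop) (r : nat) : Prop :=
  exists2 M : 'M[int]_(r, n), forall i, E (row i M) & row_free (map_mx intr M : 'M[R]_(r, n)).

(** A maximal independent family [M] in [E] has at most [n] rows, so its Smith form has a zero last
    column. All of [E] lies in the real row space of [M], and a transposition moves that column to
    the front. *)
Lemma unimod_hyperplane n (E : 'rV[int]_n.+1 -> Prop) : ~ indep_in E n.+1 ->
  exists2 U : 'M[int]_n.+1, U \in unitmx & forall z, E z -> (z *m U) 0 0 = 0.
Proof.
move=> nE; pose P r := `[< indep_in E r >].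
have P0 : exists r, P r.
  exists 0%N; apply/asboolP; exists 0; first by case.
  by rewrite /row_free -leqn0 rank_leq_row.
have Pb r : P r -> (r <= n.+1)%N.
  by move=> /asboolP[M _ /eqP <-]; exact: rank_leq_col.
case: (ex_maxnP P0 Pb) => r /asboolP[M EM fM] rmax.
have rn : (r <= n)%N.
  rewrite -ltnS ltn_neqAle (Pb r) ?andbT; last by apply/asboolP; exists M.
  by apply/eqP => e; subst r; apply: nE; exists M.
have sub z : E z -> (intvec R z <= (map_mx intr M : 'M[R]_(r, n.+1)))%MS.
  move=> Ez; apply/negP => /negP h; have := rmax (r + 1)%N; rewrite addn1 ltnn => /(_ _)/negP; apply.
    rewrite -addn1; apply/asboolP; exists (col_mx M z).
      move=> i; rewrite -(fintype.splitK i); case: (fintype.split i) => k /=.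
        by rewrite rowKu.
      by rewrite rowKd (ord1 k) (_ : row 0 z = z)//; apply/rowP => j; rewrite mxE.
    by rewrite map_col_mx; apply: row_free_col_mx.
  by [].
have [L uL [V uV [s _ e]]] := int_Smith_normal_form M.
have M0 i : (M *m invmx V) i ord_max = 0.
  rewrite e mulmxK// mxE big1// => k _; rewrite mxE.
  by rewrite ltn_eqF ?mulr0n ?mulr0//= (leq_trans (ltn_ord k)).
exists (invmx V *m tperm_mx 0 ord_max); first by rewrite unitmx_mul unitmx_inv uV unitmx_perm.
move=> z Ez; rewrite mulmxA -xcolE mxE perm.tpermL; apply: (@intr_inj R).
have /submxP[Y eY] := sub z Ez.
have : intvec R (z *m invmx V) = Y *m map_mx intr (M *m invmx V).
  by rewrite intvec_mul eY map_mxM mulmxA.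
move=> /(congr1 (fun x : 'rV_n.+1 => x 0 ord_max)); rewrite [LHS]mxE => ->.
by rewrite mxE big1// => k _; rewrite mxE M0 mulr0.
Qed.

(** This is the block diagonal matrix with blocks [1] and [U]. *)
Definition lift0 n (U : 'M[int]_n) : 'M[int]_n.+1 :=
  delta_mx 0 0 + proj0 n *m U *m (proj0 n)^T.

Lemma mul_lift0_0 n (U : 'M[int]_n) (z : 'rV[int]_n.+1) : (z *m lift0 U) 0 0 = z 0 0.
Proof.
rewrite mulmxDr mxE !mulmxA mul_proj0T0 addr0 mxE (bigD1 0)//= big1 ?addr0.
  by rewrite mxE !eqxx mulr1.
by move=> k k0; rewrite mxE (negPf k0) mulr0.
Qed.

Lemma mul_lift0_l n (U : 'M[int]_n) (z : 'rV[int]_n.+1) j :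
  (z *m lift0 U) 0 (lift 0 j) = (z *m proj0 n *m U) 0 j.
Proof.
rewrite mulmxDr mxE !mulmxA mul_proj0TE mxE big1 ?add0r// => k _.
by rewrite mxE andbC (eq_sym (lift _ _)) (negPf (neq_lift _ _)) mulr0.
Qed.

Lemma lift0_unit n (U : 'M[int]_n) : U \in unitmx -> lift0 U \in unitmx.
Proof.
move=> uU; suff /mulmx1_unit[] : lift0 U *m lift0 (invmx U) = 1%:M by [].
apply/row_matrixP => i; rewrite row_mul; apply/rowP => j.
have pE (V : 'M[int]_n) (y : 'rV[int]_n.+1) : y *m lift0 V *m proj0 n = y *m proj0 n *m V.
  by apply/rowP => k; rewrite mul_proj0 mul_lift0_l.
rewrite rowE; have [k ->|->] := unliftP 0 j; last first.
  by rewrite !mul_lift0_0 rowE mulmx1.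
by rewrite mul_lift0_l pE mulmxK// mul_proj0 rowE mulmx1.
Qed.

(** The largest set of the chain is put into the hyperplane of vanishing first coordinate; the
    induction then treats the projections of the smaller ones. Independent projections have
    independent preimages. *)
Lemma flag_basis n (E : nat -> 'rV[int]_n -> Prop) :
  (forall i z, E i z -> E i.+1 z) -> (forall i, (i < n)%N -> ~ indep_in (E i) i.+1) ->
  exists2 U : 'M[int]_n, U \in unitmx &
    forall i z, (i < n)%N -> E i z -> forall j : 'I_n, (j < n - i)%N -> (z *m U) 0 j = 0.
Proof.
elim: n E => [|n IH] E Emono Eind; first by exists 1%:M; rewrite ?unitmx1.
have Emn i z : (i <= n)%N -> E i z -> E n z.
  by move=> /subnK <-; elim: (n - i)%N => // m IHm /IHm/Emono.
have [U1 uU1 HU1] := unimod_hyperplane (Eind n (ltnSn n)).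
have [||U2 uU2 HU2] := IH (fun i w => exists2 z, E i z & w = z *m U1 *m proj0 n).
- by move=> i w [z Ez ->]; exists z => //; exact: Emono.
- move=> i lin [M EM fM]; apply: (Eind i (ltnW lin)).
  have /choice[f Hf] : forall k, exists z, E i z /\ row k M = z *m U1 *m proj0 n.
    by move=> k; have [z] := EM k; exists z.
  exists (\matrix_k f k); first by move=> k; rewrite rowK; case: (Hf k).
  have eM : M = (\matrix_k f k) *m (U1 *m proj0 n).
    by apply/row_matrixP => k; rewrite row_mul rowK mulmxA (Hf k).2.
  move: fM; rewrite eM map_mxM /row_free => /eqP e; rewrite eqn_leq rank_leq_row/=.
  by rewrite -{1}e mxrankM_maxl.
exists (U1 *m lift0 U2); first by rewrite unitmx_mul uU1 lift0_unit.
move=> i z; rewrite ltnS => lin Ez j; rewrite mulmxA.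
have [k ->|-> _] := unliftP 0 j; last by rewrite mul_lift0_0 HU1//; exact: Emn Ez.
rewrite mul_lift0_l /= /bump/= add1n subSn// ltnS => kn.
by apply: (HU2 i) => //; [lia|exists z].
Qed.

End Flag.

(** * Minkowski's second theorem *)

Section SecondTheorem.
Variable R : realType.

(** The integers [A k] are such that [A k / Q] lies below [L k]. The chain is run with [t = G] and
    [q = G * Q]: it starts with at least [c n * (A 0 * G) ^ n] points and ends with at most
    [(G * Q) ^ n] residues. *)
Lemma leading_minkowski n (vs : seq 'rV[int]_n) (A : nat -> nat) (L : nat -> R) (Q : nat) (c : nat -> R) :
  (forall B : nat, exists (h : R) (y : 'rV[int]_n), 0 <= h /\
    forall x : 'rV[R]_n, (forall j, `|x 0 j| <= B%:R) -> zon vs h (x + intvec R y)) ->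
  (forall i, 0 <= c i) ->
  (forall k : nat, (size (latpts vs (k%:R : R)))%:R = \sum_(i < n.+1) c i * k%:R ^+ i) ->
  (forall i, 0 < A i)%N -> (forall i, A i <= A i.+1)%N ->
  (forall i (l : R) z, (i < n)%N -> 0 < l < L i -> lattice_diff vs l z ->
     forall j : 'I_n, (j < n - i)%N -> z 0 j = 0) ->
  (0 < Q)%N -> (forall k, (k < n)%N -> (A k)%:R < Q%:R * L k) ->
  c n * \prod_(k < n) (A k)%:R <= Q%:R ^+ n.
Proof.
move=> hbox c0 ck A0 AS flag Q0 AL.
have [C C0 HC] := residue_count_chain hbox A0 AS flag (leqnn n).
have [G G0 HG] : exists2 G : nat, (0 < G)%N &
    forall k, (k < n)%N -> (A k)%:R * G%:R + C < (G * Q)%:R * L k.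
  (* Any [G] above all the quotients [C / (Q * L k - A k)] absorbs the additive error [C]. *)
  pose F k := (Num.truncn (C / (Q%:R * L k - (A k)%:R))).+1.
  exists (\sum_(k < n) F k).+1 => // k kn; set G := _.+1.
  have d0 : 0 < Q%:R * L k - (A k)%:R by rewrite subr_gt0 AL.
  have : C / (Q%:R * L k - (A k)%:R) < G%:R.
    apply: (@lt_le_trans _ _ (F k)%:R); first exact: truncnS_gt.
    by rewrite ler_nat leqW// (bigD1 (Ordinal kn))//= leq_addr.
  rewrite ltr_pdivrMr// natrM; move: (L k) => Lk; lra.
have := HC G%:R (G * Q)%N; rewrite ltr0n muln_gt0 G0 Q0 => /(_ isT isT HG).
rewrite subnn expn0 muln1 => H.
have {H} : (size (latpts vs ((A 0)%:R * G%:R : R)) * \prod_(k < n) A k <= A 0 ^ n * (G * Q) ^ n)%N.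
  by apply: (leq_trans H); rewrite leq_mul2l residue_count0_le ?orbT// muln_gt0 G0.
have ck' := ck (A 0 * G)%N; rewrite natrM in ck'.
rewrite -(ler_nat R) !natrM ck' !natrX natrM natr_prod => H.
have p0 : 0 < ((A 0)%:R * G%:R) ^+ n :> R by rewrite exprn_gt0// mulr_gt0 ?ltr0n.
rewrite -(ler_pM2l p0).
have <- : (A 0)%:R ^+ n * (G%:R * Q%:R) ^+ n = ((A 0)%:R * G%:R) ^+ n * Q%:R ^+ n :> R.
  by rewrite !exprMn mulrA.
apply: le_trans H; rewrite mulrA ler_wpM2r ?prodr_ge0//.
rewrite mulrC big_ord_recr/= lerDr sumr_ge0// => i _.
by rewrite !mulr_ge0 ?exprn_ge0 ?mulr_ge0.
Qed.

Lemma minkowski_second n (vs : seq 'rV[int]_n) (L : nat -> R) (c : nat -> R) :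
  (forall B : nat, exists (h : R) (y : 'rV[int]_n), 0 <= h /\
    forall x : 'rV[R]_n, (forall j, `|x 0 j| <= B%:R) -> zon vs h (x + intvec R y)) ->
  (forall i, 0 <= c i) ->
  (forall k : nat, (size (latpts vs (k%:R : R)))%:R = \sum_(i < n.+1) c i * k%:R ^+ i) ->
  (forall i (l : R) z, (i < n)%N -> 0 < l < L i -> lattice_diff vs l z ->
     forall j : 'I_n, (j < n - i)%N -> z 0 j = 0) ->
  0 < L 0 -> (forall i, L i <= L i.+1) ->
  c n * \prod_(k < n) L k <= 1.
Proof.
move=> hbox c0 ck flag L0 LS; apply: (@exp_limit _ n) => // e /andP[e0 e1].
have Lm i : L 0 <= L i.
  by elim: i => [|i IH]; [exact: lexx|exact: le_trans IH (LS i)].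
have Lp i : 0 < L i := lt_le_trans L0 (Lm i).
pose Q := (Num.truncn (3 / (e * L 0))).+1.
have eL : 0 < e * L 0 by rewrite mulr_gt0.
have QR : 3 < Q%:R * (e * L 0) by rewrite -ltr_pdivrMr//; exact: truncnS_gt.
have Q0 : 0 < Q%:R :> R by rewrite ltr0n.
have QL i : 3 < Q%:R * L i * e.
  by rewrite (lt_le_trans QR)// mulrAC mulrA ler_wpM2l ?mulr_ge0// ltW.
(* Subtracting one gives the strict bound [A i < Q * L i], while [3 < Q * L i * e] ensures
   [A i >= (1 - e) * Q * L i]. *)
pose A i := (Num.truncn (Q%:R * L i)).-1.
have QL3 i : 3 < Q%:R * L i.
  by rewrite (lt_le_trans (QL i))// ler_piMr ?ltW// mulr_gt0.
have t3 i : (3 <= Num.truncn (Q%:R * L i))%N.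
  by rewrite truncn_ge_nat ?ltW// (lt_trans _ (QL3 i)).
have AE i : (A i)%:R = (Num.truncn (Q%:R * L i))%:R - 1 :> R.
  by rewrite /A -[in RHS](prednK (n := Num.truncn _)) ?(leq_trans _ (t3 i))// -natr1 addrK.
have tl i : (Num.truncn (Q%:R * L i))%:R <= Q%:R * L i by rewrite truncn_le ltW// mulr_gt0.
have tg i : Q%:R * L i < (Num.truncn (Q%:R * L i))%:R + 1 by rewrite natr1; exact: truncnS_gt.
have H : c n * \prod_(k < n) (A k)%:R <= Q%:R ^+ n.
  apply: (@leading_minkowski n vs A L Q c hbox c0 ck) => //.
  - by move=> i; rewrite /A; have := t3 i; lia.
  - by move=> i; rewrite /A -!subn1 leq_sub2r// le_truncn// ler_wpM2l.
  - by move=> k _; rewrite AE; have := tl k; lra.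
rewrite -(ler_pM2l (exprn_gt0 n Q0)) mulr1 (le_trans _ H)//.
rewrite mulrA -exprMn mulrCA ler_wpM2l//.
have -> : (Q%:R * (1 - e)) ^+ n = \prod_(k < n) (Q%:R * (1 - e)).
  by rewrite prodr_const card_ord.
rewrite -big_split/=; apply: ler_prod => i _; apply/andP; split.
  by rewrite !mulr_ge0 ?subr_ge0 ?(ltW e1)// ltW.
rewrite AE; have := QL i; have := tg i; move: (Num.truncn _)%:R => T.
have -> : Q%:R * (1 - e) * L i = Q%:R * L i - Q%:R * L i * e by ring.
lra.
Qed.

End SecondTheorem.

(** * Lattice zonotopes and their successive minima *)

Section Bridge.
Variable R : realType.

Lemma zonP n (I : eqType) (s : seq I) (v : I -> 'rV[int]_n) (c : R) (x : 'rV[R]_n) :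
  0 <= c -> uniq s ->
  zon [seq v i | i <- s] c x <->
  exists t : I -> R, (forall i, 0 <= t i <= c) /\
    x = \sum_(i <- s) t i *: intvec R (v i).
Proof.
move=> c0; elim: s x => [|i s IH] x /=.
  move=> _; split; first by move=> ->; exists (fun=> 0); rewrite big_nil lexx.
  by move=> [t [_ ->]]; rewrite big_nil.
move=> /andP[is0 us]; split.
  move=> [t0 t01 /(IH _ us)[t [t1 e]]].
  exists (fun j => if j == i then t0 else t j); split; first by move=> j; case: eqP.
  rewrite big_cons eqxx (eq_big_seq (fun j => t j *: intvec R (v j))) -?e ?subrKC//.
  by move=> j js; case: eqP js is0 => // -> ->.
move=> [t [t1 e]]; exists (t i) => //; apply/(IH _ us); exists t; split=> //.
by rewrite e big_cons addrC addKr.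
Qed.

Variables (n m : nat) (p v : 'I_m -> 'rV[int]_n).
Let Z := @lattice_zonotope R n m p v.
Definition gens : seq 'rV[int]_n := [seq v i | i <- enum 'I_m].
Definition base : 'rV[int]_n := \sum_i p i.
Local Notation vs := gens.

(** All base points [p i] are collected in the single integral translation [base]. *)
Lemma zonotopeP c x : 0 < c -> dilate c Z x <-> zon vs c (x - c *: intvec R base).
Proof.
move=> c0; have E (t : 'I_m -> R) : \sum_(i < m) (intvec R (p i) + t i *: intvec R (v i)) =
    intvec R base + \sum_(i < m) t i *: intvec R (v i).
  rewrite big_split/=; congr (_ + _); apply/rowP => j; rewrite summxE mxE summxE rmorph_sum/=.
  by apply: eq_bigr => i _; rewrite mxE.
split.
  move=> [y [t [t1 ->]] <-]; rewrite E scalerDr addrC addKr.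
  rewrite -[c in zon _ c _]mulr1; apply: zonZ; first exact: ltW.
  by apply/(zonP _ _ ler01 (enum_uniq _)); exists t; rewrite big_enum.
move=> H; exists (c^-1 *: x); last by rewrite scalerA divff ?gt_eqF// scale1r.
have : zon vs 1 (c^-1 *: x - intvec R base).
  by apply: (zonV c0); rewrite mulr1 scalerBr scalerA divff ?gt_eqF// scale1r.
move=> /(zonP _ _ ler01 (enum_uniq _))[t [t1]]; rewrite big_enum/= => e.
by exists t; split=> //; rewrite E -e subrKC.
Qed.

Lemma zonotope1P x : Z x <-> zon vs 1 (x - intvec R base).
Proof.
have := zonotopeP x ltr01; rewrite scale1r => <-; split.
  by move=> Zx; exists x => //; rewrite scale1r.
by move=> [y Zy <-]; rewrite scale1r.
Qed.

Lemma lattice_diff_bodyP l z : 0 < l ->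
  dilate l (diff_body Z) (intvec R z) <-> lattice_diff vs l z.
Proof.
move=> l0; split.
  move=> [_ [x Zx [y Zy <-]] e]; exists (l *: (x - intvec R base)), (l *: (y - intvec R base)).
  split; last by rewrite -e -scalerBr opprB addrA subrK.
    by rewrite -[l in zon _ l _]mulr1; apply: zonZ; [exact: ltW|exact/zonotope1P].
  by rewrite -[l in zon _ l _]mulr1; apply: zonZ; [exact: ltW|exact/zonotope1P].
move=> [a [b [za zb e]]]; exists (l^-1 *: (a - b)); last by rewrite scalerA divff ?gt_eqF// scale1r.
have H w : zon vs l w -> Z (l^-1 *: w + intvec R base).
  move=> zw; apply/zonotope1P; rewrite addrK; apply: (zonV l0).
  by rewrite mulr1 scalerA divff ?gt_eqF// scale1r.
exists (l^-1 *: a + intvec R base); first exact: H.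
exists (l^-1 *: b + intvec R base); first exact: H.
by rewrite scalerBr opprD addrACA subrr addr0.
Qed.

Lemma lattice_diff_mono (a b : R) z : a <= b -> lattice_diff vs a z -> lattice_diff vs b z.
Proof. by move=> ab [x [y [zx zy e]]]; exists x, y; split=> //; exact: zon_mono ab _. Qed.

Local Notation V := (\matrix_(i < m) intvec R (v i)).

Lemma full_dim_row_full : full_dim Z -> row_full V.
Proof.
move=> [a [Za fa]]; rewrite /row_full eqn_leq rank_leq_col/=.
have : (\matrix_(j < n) (a (lift ord0 j) - a ord0) <= V)%MS; last first.
  by move/mxrankS; rewrite (eqP fa).
apply/row_subP => j; rewrite rowK.
have [t [_ ->]] := Za (lift ord0 j); have [s [_ ->]] := Za ord0.
rewrite -sumrB; apply: summx_sub => i _.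
rewrite opprD addrACA subrr add0r -scalerBl; apply: scalemx_sub.
by have := row_sub i V; rewrite rowK.
Qed.

(** A pseudo-inverse of the generator matrix writes [x] with coefficients bounded by [C]; adding [C]
    times every generator makes them nonnegative. *)
Lemma zon_box : full_dim Z -> forall B : nat, exists (h : R) (y : 'rV[int]_n), 0 <= h /\
  forall x : 'rV[R]_n, (forall j, `|x 0 j| <= B%:R) -> zon vs h (x + intvec R y).
Proof.
move=> /full_dim_row_full fV B; pose W := pinvmx V.
pose C0 : R := \sum_(i < m) \sum_(j < n) B%:R * `|W j i|.
pose C := (Num.truncn C0).+1.
have C0C : C0 <= C%:R by apply: ltW; exact: truncnS_gt.
exists (C + C)%:R, (\sum_(i < m) v i *+ C); split=> // x xB.
apply/(zonP _ _ (ler0n _ _) (enum_uniq _)).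
exists (fun i => (x *m W) 0 i + C%:R); rewrite big_enum/=; split.
  move=> i; have : `|(x *m W) 0 i| <= C%:R.
    apply: le_trans C0C; rewrite /C0 (bigD1 i)//= ler_wpDr//.
      by apply: sumr_ge0 => k _; apply: sumr_ge0 => j _; rewrite mulr_ge0.
    rewrite mxE (le_trans (ler_norm_sum _ _ _))//; apply: ler_sum => j _.
    by rewrite normrM ler_wpM2r.
  by rewrite ler_norml natrD => /andP[? ?]; apply/andP; split; lra.
have {1}-> : x = x *m W *m V by rewrite mulmxKpV// submx_full.
rewrite mulmx_sum_row; under [RHS]eq_bigr do rewrite scalerDl.
rewrite big_split/=; congr (_ + _); first by apply: eq_bigr => i _; rewrite rowK.
apply/rowP => j; rewrite mxE !summxE rmorph_sum/=; apply: eq_bigr => i _.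
by rewrite !mxE mulmxnE rmorphMn/= mulr_natl.
Qed.

Lemma latpts_translate k : (0 < k)%N -> card_is (lattice_pts Z k) (size (latpts vs (k%:R : R))).
Proof.
move=> k0; exists [seq z + base *+ k | z <- latpts vs (k%:R : R)]; split.
  by rewrite map_inj_uniq ?latpts_uniq//; exact: addIr.
split; last by rewrite size_map.
have kR : 0 < k%:R :> R by rewrite ltr0n.
move=> z; rewrite /lattice_pts/=; split.
  move=> /mapP[y /(mem_latpts _ _ (ltW kR)) zy ->]; apply/(zonotopeP _ kR).
  by rewrite intvecD intvecMn addrK.
move=> /(zonotopeP _ kR) zz; apply/mapP; exists (z - base *+ k); last by rewrite subrK.
by apply/(mem_latpts _ _ (ltW kR)); rewrite intvecB intvecMn.
Qed.

(* The first alternative covers an infinite iterated integral, where [fine] returns [0]. *)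
Lemma vol_lower_bound (c : nat -> R) : full_dim Z -> (forall i, 0 <= c i) ->
  (forall k : nat, (size (latpts vs (k%:R : R)))%:R = \sum_(i < n.+1) c i * k%:R ^+ i) ->
  vol Z = 0 \/ c n <= vol Z.
Proof.
move=> fZ c0 ck; have v0 := ivol_ge0 Z; rewrite /vol.
case E : (ivol Z) v0 => [w| |] v0; [|by left|by left].
move: v0.
rewrite lee_fin => w0; right; apply: (@exp_limit _ n) => //= e /andP[e0 e1].
have [h [y [h0 hy]]] := zon_box fZ 1.
pose r := (Num.truncn h).+1; have hr : h <= r%:R by apply: ltW; exact: truncnS_gt.
(* This gives [r < k e], hence [(1 - e) (k + r) <= k]. *)
pose k := (Num.truncn (r%:R / e)).+1.
have kr : r%:R < k%:R * e by rewrite -ltr_pdivrMr//; exact: truncnS_gt.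
pose q : R := (k + r)%:R.
have q0 : 0 < q by rewrite ltr0n.
(* The unit cubes at these points lie in [(k + r) Z], since [zon_box] places the offset inside a
   cube, shifted by [y], in the summand scaled by [r]. *)
pose s := [seq z + y + base *+ (k + r) | z <- latpts vs (k%:R : R)].
have us : uniq s by rewrite map_inj_uniq ?latpts_uniq// => ? ? /addIr/addIr.
have sub : cubes s q `<=` Z.
  move=> x [_ /mapP[z /(mem_latpts _ _ (ler0n _ _)) zz ->] H].
  apply/zonotope1P/(zonV q0); rewrite mulr1 scalerBr.
  pose d := q *: x - intvec R (z + y + base *+ (k + r)).
  have -> : q *: x - q *: intvec R base = intvec R z + (d + intvec R y).
    by rewrite /d !intvecD intvecMn; apply/rowP => j; rewrite !mxE; ring.
  rewrite /q natrD; apply: zonD => //; apply: (zon_mono hr); apply: hy => j.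
  have := H j; rewrite /d !mxE; move: (intr _) => u; rewrite -/q => /andP[? ?].
  by rewrite ler_norml; apply/andP; split; lra.
have := ivol_mono sub; rewrite (ivol_cubes q0 us) E lee_fin size_map ck.
rewrite ler_pdivrMr ?exprn_gt0// => H; have qn0 : 0 < q ^+ n by rewrite exprn_gt0.
rewrite -(ler_pM2l qn0) (mulrC _ w) (le_trans _ H)// mulrA -exprMn.
rewrite big_ord_recr/= ler_wpDl ?sumr_ge0// => [i _|]; first by rewrite mulr_ge0 ?exprn_ge0.
rewrite mulrC ler_wpM2l// lerXn2r ?nnegrE ?mulr_ge0 ?subr_ge0 ?(ltW e1) ?(ltW q0)//.
rewrite /q natrD mulrBr mulr1 mulrDl; have : 0 <= r%:R * e by rewrite mulr_ge0// ltW.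
lra.
Qed.

Lemma affdim_geS (S : set 'rV[R]_n) k : affdim_ge S k.+1 -> affdim_ge S k.
Proof.
move=> [a [Sa fa]]; exists (fun j => a (widen_ord (leqnSn k.+1) j)); split=> //.
set M := \matrix_(j < k.+1) _ in fa.
pose A := \matrix_(j < k) row (widen_ord (leqnSn k) j) M.
rewrite (_ : \matrix_(j < k) _ = A).
  apply/inj_row_free => w; rewrite mulmx_sum_row => w0.
  pose u : 'rV[R]_k.+1 := \row_j oapp (fun i => w 0 i) 0 (insub (val j)).
  have uE i : u 0 (widen_ord (leqnSn k) i) = w 0 i by rewrite mxE /= valK.
  have : u *m M = 0.
    rewrite mulmx_sum_row big_ord_recr/= [u 0 ord_max]mxE insubF ?ltnn//= scale0r addr0.
    by rewrite -[RHS]w0; apply: eq_bigr => i _; rewrite uE [in RHS]/A [in RHS]rowK.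
  move=> /eqP; rewrite mulmx_free_eq0// => /eqP u0.
  by apply/rowP => i; rewrite -uE u0 !mxE.
apply/row_matrixP => j; rewrite !rowK; congr (a _ - a _); exact: val_inj.
Qed.

End Bridge.

Lemma card_is_uniq n (S : set 'rV[int]_n) N N' : card_is S N -> card_is S N' -> N = N'.
Proof.
move=> [s [us [sS <-]]] [s' [us' [sS' <-]]]; apply/perm_size/uniq_perm => // z.
by apply/idP/idP => [/sS/sS'|/sS'/sS].
Qed.

(** The difference polynomial has degree at most [n] and the [n + 1] roots [1, ..., n + 1]. *)
Lemma poly_coef_unique (R : realFieldType) n (g c : nat -> R) :
  (forall k, (0 < k)%N -> \sum_(i < n.+1) g i * k%:R ^+ i = \sum_(i < n.+1) c i * k%:R ^+ i) ->
  forall i, (i <= n)%N -> g i = c i.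
Proof.
move=> H i lin; pose P := \poly_(i < n.+1) (g i - c i).
suff : P`_i = 0 by rewrite coef_poly ltnS lin => /eqP; rewrite subr_eq0 => /eqP.
suff -> : P = 0 by rewrite coef0.
apply: (@roots_geq_poly_eq0 _ _ [seq k.+1%:R | k <- iota 0 n.+1]).
- apply/allP => _ /mapP[k _ ->]; rewrite rootE horner_poly.
  rewrite (eq_bigr _ (fun i _ => mulrBl _ _ _)) sumrB H// subrr //.
- by rewrite map_inj_uniq ?iota_uniq// => a b /eqP; rewrite eqr_nat => /eqP[].
- by rewrite size_map size_iota size_poly.
Qed.

(** * Successive minima of [DZ] and the resulting coefficient bounds *)

Section SuccMin.
Variables (R : realType) (n m : nat) (p v : 'I_m -> 'rV[int]_n).
Let Z := @lattice_zonotope R n m p v.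
Hypothesis fZ : full_dim Z.
Local Notation vs := (gens v).
Local Notation lam := (succ_min (diff_body Z)).
Local Notation scales k :=
  [set l : R | 0 < l /\ affdim_ge (dilate l (diff_body Z) `&` @latticeR R n) k].

Lemma scales_lbound k : has_lbound (scales k).
Proof. by exists 0 => l [/ltW]. Qed.

(** The origin lies in [l DZ] and serves as the base point of the affinely independent family. *)
Lemma scales_indep (l : R) r (M : 'M[int]_(r, n)) :
  0 < l -> (forall i, lattice_diff vs l (row i M)) -> row_free (map_mx intr M : 'M[R]_(r, n)) ->
  scales r l.
Proof.
move=> l0 HM fM; split=> //.
exists (fun j => if unlift ord0 j is Some i then intvec R (row i M) else 0); split.
  move=> j; case: unliftP => [i|] _.
    by split; [exact/lattice_diff_bodyP|exists (row i M)].
  split; last by exists 0; rewrite intvec0.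
  rewrite -(intvec0 R n); apply/lattice_diff_bodyP => //.
  by exists 0, 0; rewrite subr0 intvec0; split=> //; apply: zon0; exact: ltW.
rewrite (_ : \matrix_(j < r) _ = map_mx intr M)//.
apply/row_matrixP => j; rewrite rowK liftK unlift_none subr0.
by apply/rowP => k; rewrite !mxE.
Qed.

Lemma scales_neq0 k : (k <= n)%N -> scales k !=set0.
Proof.
move=> kn; have [h [y [h0 hy]]] := zon_box fZ 1.
pose M : 'M[int]_(k, n) := \matrix_i delta_mx 0 (widen_ord kn i).
exists (h + 1); apply: (@scales_indep _ _ M); first by rewrite ltr_wpDl.
  move=> i; rewrite rowK; apply: (@lattice_diff_mono _ _ _ _ h); first by rewrite lerDl.
  exists (intvec R (delta_mx 0 (widen_ord kn i)) + intvec R y), (0 + intvec R y); split.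
  - by apply: hy => j; rewrite !mxE; case: (_ && _); rewrite ?normr1 ?normr0.
  - by apply: hy => j; rewrite mxE normr0.
  - by rewrite add0r addrK.
apply/inj_row_free => w w0; apply/rowP => i.
move/rowP/(_ (widen_ord kn i)) : w0; rewrite mxE (bigD1 i)//= big1 ?addr0.
  by rewrite !mxE !eqxx mulr1.
by move=> j ji; rewrite !mxE eqxx/= -val_eqE/= val_eqE eq_sym (negPf ji) mulr0.
Qed.

Lemma succ_min_le k l : scales k l -> lam k <= l.
Proof. by move=> H; apply: ge_inf => //; exact: scales_lbound. Qed.

Lemma succ_min_mono k : (k < n)%N -> lam k <= lam k.+1.
Proof.
move=> kn; apply: lb_le_inf; first exact: scales_neq0.
by move=> l [l0 /affdim_geS H]; apply: succ_min_le.
Qed.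

(** Of two affinely independent lattice points one is nonzero, with an entry at least [1] in
    absolute value, while the entries of points of [l DZ] are at most [l * M]. *)
Lemma succ_min_gt0 k : (0 < k <= n)%N -> 0 < lam k.
Proof.
case: k => // k /= kn; have [M M0 HM] := zon_bound R vs.
have M0R : 0 < M%:R :> R by rewrite ltr0n.
apply: (@lt_le_trans _ _ M%:R^-1); first by rewrite invr_gt0.
apply: lb_le_inf; first exact: scales_neq0.
move=> l [l0 [a [Sa fa]]].
have [z nz dz] : exists2 z, z != 0 & lattice_diff vs l z.
  have [z0 ez0] := (Sa ord0).2; have [z1 ez1] := (Sa (lift ord0 ord0)).2.
  have d0 : lattice_diff vs l z0 by apply/(lattice_diff_bodyP p v _ l0); rewrite -ez0; exact: (Sa ord0).1.
  have d1 : lattice_diff vs l z1 by apply/(lattice_diff_bodyP p v _ l0); rewrite -ez1; exact: (Sa _).1.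
  have [e0|] := eqVneq z0 0; last by exists z0.
  have [e1|] := eqVneq z1 0; last by exists z1.
  have := @mulmx_free_eq0 _ 1 _ _ (delta_mx 0 ord0) _ fa.
  rewrite -rowE rowK ez0 ez1 e0 e1 subrr eqxx => /esym/eqP/rowP/(_ ord0).
  by rewrite !mxE !eqxx => /eqP; rewrite oner_eq0.
have [j zj] : exists j, z 0 j != 0.
  apply/existsP; apply: contraNT nz; rewrite negb_exists => /forallP z0.
  by apply/eqP/rowP => j; rewrite mxE; apply/eqP; have := z0 j; rewrite negbK.
have [x [y [zx zy e]]] := dz; have := HM _ _ _ zx zy (ltW l0) j.
rewrite -e mxE -intr_norm => H; rewrite -(ler_pM2r M0R) mulVf ?gt_eqF//.
by apply: le_trans H; rewrite ler1z -gtz0_ge1 normr_gt0.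
Qed.

(** Some admissible scale lies below [l]; the differences of its [k + 1] points span dimension [k],
    too much for [A]. *)
Lemma succ_min_escapes k l : (k <= n)%N -> lam k < l -> escapes R (lattice_diff vs l) k.
Proof.
move=> kn kl r A rk.
have [|x [x0 [a [Sa fa]]] xl] := @inf_adherent R (scales k) (l - lam k) _
   (conj (scales_neq0 kn) (scales_lbound k)).
  by rewrite subr_gt0.
rewrite -/(succ_min _ _) subrKC in xl.
apply: contrapT => nE; have sub j : (a j <= A)%MS.
  have [z ez] := (Sa j).2; rewrite ez; apply/negPn/negP => zA; apply: nE; exists z => //.
  apply: (lattice_diff_mono (ltW xl)); apply/(lattice_diff_bodyP p v _ x0); rewrite -ez.
  exact: (Sa j).1.
have : (\matrix_(j < k) (a (lift ord0 j) - a ord0) <= A)%MS.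
  apply/row_subP => j; rewrite rowK; apply: addmx_sub => //.
  by rewrite -scaleN1r scalemx_sub.
by move/mxrankS; rewrite (eqP fa) leqNgt (leq_ltn_trans (rank_leq_row A)).
Qed.

(** Finitely many scales below the infimum have a maximum still below it, at which all the vectors
    would be present. *)
Lemma succ_min_flag i : (i < n)%N ->
  ~ indep_in R (fun z => exists2 l : R, 0 < l < lam i.+1 & lattice_diff vs l z) i.+1.
Proof.
move=> lin [M HM fM].
have /choice[f Hf] : forall k, exists l : R, 0 < l < lam i.+1 /\ lattice_diff vs l (row k M).
  by move=> k; have [l] := HM k; exists l.
pose l := \big[Num.max/f ord0]_k f k.
have fl k : f k <= l by exact: le_bigmax.
have ll : l < lam i.+1.
  by apply: bigmax_lt => [|k _]; [have [/andP[]] := Hf ord0|have [/andP[]] := Hf k].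
have : lam i.+1 <= l.
  apply/succ_min_le/(@scales_indep _ _ M) => //.
    by apply: lt_le_trans (fl ord0); have [/andP[]] := Hf ord0.
  by move=> k; apply: (lattice_diff_mono (fl k)); case: (Hf k).
by rewrite leNgt ll.
Qed.

(** In the basis from [flag_basis], the lattice points of [l DZ] with [l < lam i.+1] have their
    first [n - i] coordinates equal to zero; the counts do not change. *)
Lemma zonotope_minkowski (c : nat -> R) :
  (forall i, 0 <= c i) ->
  (forall k : nat, (size (latpts vs (k%:R : R)))%:R = \sum_(i < n.+1) c i * k%:R ^+ i) ->
  c n * \prod_(k < n) lam k.+1 <= 1.
Proof.
move=> c0 ck; have [n0|n0] := posnP n.
  (* Every [lam k.+1] is then the infimum of an empty set, so that positivity fails. *)
  have -> : \prod_(k < n) lam k.+1 = \prod_(k < n) 1.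
    by apply: eq_bigr => k _; have := ltn_ord k; rewrite [X in (_ < X)%N]n0.
  by apply: (minkowski_second (L := fun=> 1) (zon_box fZ) c0 ck) => // i l z; rewrite [X in (_ < X)%N]n0.
(* The minima are continued as a constant, because beyond [n] the set of scales is empty and
   monotonicity would fail. *)
pose L i := lam (minn i n.-1).+1.
have LE i : (i < n)%N -> L i = lam i.+1 by move=> lin; rewrite /L (minn_idPl _)//; lia.
have LS i : L i <= L i.+1.
  have [lin|nli] := ltnP i.+1 n; first by rewrite !LE ?succ_min_mono// ltnW.
  by rewrite /L !(minn_idPr _)//; lia.
have L0 : 0 < L 0 by rewrite LE//; apply: succ_min_gt0.
have [||U uU HU] := @flag_basis R n (fun i z => exists2 l : R, 0 < l < L i & lattice_diff vs l z).
- by move=> i z [l /andP[l0 lL] dz]; exists l => //; rewrite l0 (lt_le_trans lL).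
- by move=> i lin; rewrite LE//; exact: succ_min_flag.
have -> : \prod_(k < n) lam k.+1 = \prod_(k < n) L k by apply: eq_bigr => k _; rewrite LE.
apply: (@minkowski_second R n [seq z *m U | z <- vs]) => //.
(* The inverse of [U] maps the box of size [B] into the box of size [B * K]. *)
- move=> B; pose K := (\sum_i \sum_j `|invmx U i j|)%N.
  have [h [y [h0 hy]]] := zon_box fZ (B * K); exists h, (y *m U); split=> // x xB.
  have -> : x + intvec R (y *m U) = (x *m map_mx intr (invmx U) + intvec R y) *m map_mx intr U.
    by rewrite mulmxDl -mulmxA -map_mxM/= mulVmx// map_mx1 mulmx1 intvec_mul.
  apply/zon_map/hy => j; rewrite mxE (le_trans (ler_norm_sum _ _ _))// natrM /K natr_sum mulr_sumr.
  apply: ler_sum => k _; rewrite mxE normrM ler_pM//.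
  rewrite natr_sum (bigD1 j)//= ler_wpDr ?sumr_ge0//.
  by rewrite natr_absz intr_norm.
- by move=> k; rewrite -ck size_latpts_unimod.
- move=> i l z lin ll [x [y [zx zy e]]] j ji.
  have [a [b [za zb e']]] := zon_unimodB uU zx zy e.
  have := HU i (z *m invmx U) lin _ j ji; rewrite mulmxKV//; apply.
  by exists l => //; exists a, b.
Qed.

(** The bound is applied at the scales [lam k / (1 - e)], strictly above the infima, and [exp_limit]
    lets [e] tend to [0]. *)
Lemma coef_le_leading (c : nat -> R) i : (i <= n)%N ->
  (forall i, 0 <= c i) ->
  (forall i, c i <= subsum vs i (fun S => (mincompl S)%:R)) ->
  c n = subsum vs n (fun S => `|detl S|%:R) ->
  c i <= n`!%:R / i`!%:R * \prod_(i.+1 <= k < n.+1) lam k * c n.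
Proof.
move=> lin c0 cm cn; have K0 : 0 <= n`!%:R / i`!%:R :> R by rewrite divr_ge0.
have lam0 k : (i.+1 <= k < n.+1)%N -> 0 < lam k.
  by move=> /andP[ik kn]; apply: succ_min_gt0; lia.
have P0 : 0 <= \prod_(i.+1 <= k < n.+1) lam k.
  by rewrite big_nat; apply: prodr_ge0 => k /lam0/ltW.
apply: (@exp_limit _ (n - i)); first by rewrite !mulr_ge0.
move=> e /andP[e0 e1]; have e1' : 0 < 1 - e by rewrite subr_gt0.
pose l k := if (i.+1 <= k < n.+1)%N then lam k / (1 - e) else 0.
have l0 k : 0 <= l k by rewrite /l; case: ifP => // /lam0 ?; rewrite divr_ge0// ltW.
have := @subsum_mincompl_le R n vs i l lin l0.
have -> : \prod_(i.+1 <= k < n.+1) l k =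
    \prod_(i.+1 <= k < n.+1) lam k / (1 - e) ^+ (n - i).
  rewrite big_nat (eq_bigr (fun k => lam k * (1 - e)^-1)); last by move=> k /= h; rewrite /l h.
  by rewrite -big_nat big_split/= prodr_const_nat subSS exprVn.
rewrite -cn => H.
have {}H : c i <= n`!%:R / i`!%:R * (\prod_(i.+1 <= k < n.+1) lam k / (1 - e) ^+ (n - i)) * c n.
  apply: (le_trans (cm i)); apply: H => k /andP[ik kn].
  have h : (i.+1 <= k < n.+1)%N by rewrite ik ltnS kn.
  apply: succ_min_escapes => //; rewrite /l h ltr_pdivlMr// gtr_pMr ?lam0//.
  by rewrite gtrBl.
have := ler_wpM2l (exprn_ge0 (n - i) (ltW e1')) H.
move/le_trans; apply; rewrite le_eqVlt; apply/orP; left; apply/eqP.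
have i0 : i`!%:R != 0 :> R by rewrite pnatr_eq0 -lt0n fact_gt0.
have en0 : (1 - e) ^+ (n - i) != 0 by rewrite gt_eqF// exprn_gt0.
by field; rewrite i0 en0.
Qed.

End SuccMin.

Unset Implicit Arguments.

Theorem theorem1p5 (R : realType) (n m : nat) (p v : 'I_m -> 'rV[int]_n)
  (g : nat -> R) :
  let Z := @lattice_zonotope R n m p v in
  full_dim Z ->
  (forall k : nat, (0 < k)%N ->
     exists N : nat, card_is (lattice_pts Z k) N /\
       N%:R = \sum_(i < n.+1) g i * k%:R ^+ i) ->
  forall i : nat, (i <= n)%N ->
    g i / vol Z <= (n`!)%:R / (i`!)%:R *
                   \prod_(i.+1 <= j < n.+1) succ_min (diff_body Z) j
    /\ g i <= (n`!)%:R / (i`!)%:R * sigmaZ Z i.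
Proof.
move=> Z fZ gP i lin; set lam := succ_min _.
have [c [c0 ck cm cn]] := ehrhart_zon R (gens v).
(* Both polynomials count the lattice points of [kZ] for every positive [k]. *)
have -> : g i = c i.
  apply: (poly_coef_unique _ lin) => k k0; rewrite -ck.
  have [N [HN <-]] := gP k k0.
  by rewrite (card_is_uniq HN (latpts_translate R p v k0)).
have main := coef_le_leading fZ lin c0 cm cn; rewrite -/Z -/lam in main.
have lam0 k : (0 < k <= n)%N -> 0 < lam k by exact: succ_min_gt0.
set K := _ / _ in main *; have K0 : 0 <= K by rewrite divr_ge0.
set P := \prod_(i.+1 <= k < n.+1) _ in main *.
have P0 : 0 <= P.
  rewrite /P big_nat; apply: prodr_ge0 => k /andP[ik kn]; apply/ltW/lam0; lia.
split.
  (* If [vol Z] is [0], the quotient is [0] and the bound holds by nonnegativity of its right-hand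
     side. *)
  have [->|cv] := vol_lower_bound fZ c0 ck; first by rewrite invr0 mulr0 mulr_ge0.
  have [->|vn0] := eqVneq (vol Z) 0; first by rewrite invr0 mulr0 mulr_ge0.
  have v0 : 0 < vol Z by rewrite lt_neqAle eq_sym vn0 (le_trans (c0 n)).
  by rewrite ler_pdivrMr// (le_trans main)// ler_wpM2l// mulr_ge0.
apply: (le_trans main); rewrite -mulrA ler_wpM2l//.
have mink := zonotope_minkowski fZ c0 ck; rewrite -/Z -/lam in mink.
pose Q := \prod_(k < i) lam k.+1.
have Q0 : 0 < Q by apply: prodr_gt0 => k _; apply: lam0; have := ltn_ord k; lia.
have QP : \prod_(k < n) lam k.+1 = Q * P.
  rewrite /Q /P -(big_mkord xpredT (fun k => lam k.+1)) (big_cat_nat (leq0n i) lin)/=.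
  by rewrite big_mkord big_add1.
have {}mink : P * c n <= Q^-1.
  by rewrite -(ler_pM2l Q0) mulfV ?gt_eqF// mulrA -QP mulrC.
apply: (le_trans mink); rewrite /sigmaZ /elem_sym.
(* The inverse of [Q] is the summand of the elementary symmetric polynomial at the first [i]
   indices; the other summands are nonnegative. *)
pose I : {set 'I_n} := finset (fun j : 'I_n => (j < i)%N).
have cI : #|I| == i.
  by rewrite -sum1_card (eq_bigl (fun j : 'I_n => (j < i)%N)) => [|j];
    rewrite ?inE// -(big_ord_widen n (fun=> 1%N) lin) sum_nat_const card_ord muln1.
rewrite (bigD1 I)//= -[leLHS]addr0 lerD//.
  rewrite (eq_bigl (fun j : 'I_n => (j < i)%N)) => [|j]; last by rewrite inE.
  by rewrite -(big_ord_widen n (fun j => (lam j.+1)^-1) lin) prodfV.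
apply: sumr_ge0 => J _; apply: prodr_ge0 => j _.
by rewrite invr_ge0 ltW//; apply: lam0; have := ltn_ord j; lia.
Qed.
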